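(* Let $\mathcal E$ be a real vector space with a symmetric $\mathbb R$-bilinear form $\langle\,,\rangle$. Let $(\Psi,\Delta)$ and $(\widetilde\Phi,\widetilde\Pi)$ be two based root systems in $(\mathcal E,\langle\,,\rangle)$ with associated Coxeter systems $(W',I)$ and $(\widetilde W,\widetilde J)$ respectively. Let $\mathcal C=\mathcal C_{(W',I)}$ be the fundamental chamber and $\mathcal X=\mathcal X_{(W',I)}$ the Tits cone of $(W',I)$. Assume that $W'(\widetilde\Pi)\subseteq\widetilde\Pi$. Then $W'$ acts as a group of automorphisms of the based root system $(\widetilde\Phi,\widetilde\Pi)$, and also (by conjugation) as a group of automorphisms of the Coxeter system $(\widetilde W,\widetilde J)$. Let $W$ denote the subgroup of $O(\mathcal E,\langle\,,\rangle)$ generated by $W'\cup\widetilde W$. Then $W=\widetilde W\rtimes W'$. Under these assumptions the following conditions are equivalent: (i) there is a based root system $(\Phi,\Pi)$ in $(\mathcal E,\langle\,,\rangle)$ with $\Delta\subseteq\Pi\subseteq\Delta\cup\widetilde\Pi$ and $\widetilde\Pi=W'(\Pi\setminus\Delta)$; (ii) $\Delta\cup\widetilde\Pi$ is positively independent and $\widetilde\Pi\subseteq-\mathcal X$. Assume that conditions (i)–(ii) hold. Then $\Pi=\Delta\,\sqcup\,(\widetilde\Pi\cap-\mathcal C)$ (disjoint union; so $(\Phi,\Pi)$ is uniquely determined in (i)), $\Psi\cup\widetilde\Phi\subseteq\Phi$, and $\widetilde\Phi_+\subseteq-\mathcal X$. Set $S:=\{s_\alpha : \alpha\in\Pi\}$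 and $J=S\setminus I$. Then $(W,S)$ is the Coxeter system associated to the based root system $(\Phi,\Pi)$, $\widetilde J=\{wsw^{-1} : w\in W',\ s\in J\}$, and no element of $I$ is conjugate in $W$ to any element of $J$. The semidirect product decomposition $W=\widetilde W\rtimes W'$ is the one attached to the subsets $I$ and $J$ of $S$, namely $W=\widetilde W\rtimes W_I$ where $W_I=W'$ is the subgroup generated by $I$ and $\widetilde W$ is the subgroup generated by all $wsw^{-1}$ with $w\in W_I$, $s\in J$.
   Context: A subset $\Pi\subseteq\mathcal E$ is positively independent if $\sum_{\alpha\in\Pi}c_\alpha\alpha=0$ (finite sum) with all $c_\alpha\ge0$ implies all $c_\alpha=0$. For $\alpha\in\mathcal E$ with $\langle\alpha,\alpha\rangle=1$, the reflection $s_\alpha\colon\mathcal E\to\mathcal E$ is $s_\alpha(v)=v-2\langle v,\alpha\rangle\alpha$. Let $\mathrm{COS}=\{\cos(\pi/m) : m\in\mathbb N_{\ge2}\}\cup\mathbb R_{\ge1}$. $O(\mathcal E,\langle\,,\rangle)$ is the group of linear automorphisms of $\mathcal E$ preserving the form. Let $\Pi\subseteq\mathcal E$ be such that: $\Pi$ is positively independent; $\langle\alpha,\alpha\rangle=1$ for all $\alpha\in\Pi$; and $\langle\alpha,\beta\rangle\in-\mathrm{COS}$ for all $\alpha\ne\beta$ in $\Pi$. Let $S=\{s_\alpha : \alpha\in\Pi\}$, let $W$ be the subgroup of $O(\mathcal E,\langle\,,\rangle)$ generated by $S$, let $\Phi=\{w(\alpha) : w\in W,\alpha\in\Pi\}$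 and $\Phi_+=\Phi\cap\bigl(\sum_{\alpha\in\Pi}\mathbb R_{\ge0}\alpha\bigr)$. Then $(W,S)$ is a Coxeter system and $\Phi=\Phi_+\sqcup-\Phi_+$. One says that $(\Phi,\Pi)$ is a based root system in $(\mathcal E,\langle\,,\rangle)$ with associated Coxeter system $(W,S)$. An automorphism of $(\Phi,\Pi)$ is an element of $O(\mathcal E,\langle\,,\rangle)$ which restricts to permutations of both $\Pi$ and $\Phi$. An automorphism of a Coxeter system is a group automorphism mapping the set of Coxeter generators onto itself. The fundamental chamber is $\mathcal C_{(W,S)}=\{\rho\in\mathcal E : \langle\alpha,\rho\rangle\ge0\text{ for all }\alpha\in\Pi\}$ and the Tits cone is $\mathcal X_{(W,S)}=\bigcup_{w\in W}w(\mathcal C_{(W,S)})$. In particular $\mathcal C_{(W',I)}$ and $\mathcal X_{(W',I)}$ are formed using $\Delta$ and $W'$, and $\widetilde\Phi_+$ denotes the positive roots of $(\widetilde\Phi,\widetilde\Pi)$. $W'(A)$ denotes $\{w(\alpha) : w\in W',\alpha\in A\}$. *)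

(* Defs.v *)
From HB Require Import structures.
From mathcomp Require Import all_boot all_order all_algebra.
From mathcomp Require Import boolp classical_sets functions reals trigo.
From mathcomp Require Import ring.

Set Implicit Arguments.
Unset Strict Implicit.
Unset Printing Implicit Defensive.

Import Order.TTheory GRing.Theory Num.Theory.

Local Open Scope classical_set_scope.
Local Open Scope ring_scope.

Section Groups.

Variable G : groupType.
Implicit Types (W S N H : set G).

Definition is_subgroup H : Prop :=
  [/\ H 1%g, (forall x y, H x -> H y -> H (x * y)%g)
    & forall x, H x -> H (x^-1)%g].

Definition generated (A : set G) : set G := smallest is_subgroup A.

(* [W = N ><| H], where [N] is the normal factor. *)
Definition semidirect W N H : Prop :=
  [/\ is_subgroup N, is_subgroup H,
      (forall w n, W w -> N n -> N (w * n * w^-1)%g),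
      W = [set (n * h)%g | n in N & h in H]
    & N `&` H = [set 1%g]].

(* [W] has the presentation < S | (s t)^m(s,t) = 1 >, with [m(s,t)] the order
   of [s t] (no relation if that order is infinite), stated as the universal
   property of Bourbaki, Lie IV.1.3. Quantifying over all [n] such that
   [(s t)^n = 1], i.e. over all multiples of [m(s,t)], gives the same
   relations. *)
Definition coxeter_system W S : Prop :=
  [/\ W = generated S,
      (forall s, S s -> s <> 1%g /\ (s * s = 1)%g)
    & forall (K : groupType) (f : G -> K),
        (forall s t n, S s -> S t ->
           ((s * t) ^+ n = 1)%g -> ((f s * f t) ^+ n = 1)%g) ->
        exists g : G -> K,
          (forall x y, W x -> W y -> g (x * y)%g = (g x * g y)%g) /\
          (forall s, S s -> g s = f s)].

Definition coxeter_automorphism W S (f : G -> G) : Prop :=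
  [/\ set_bij W W f,
      (forall x y, W x -> W y -> f (x * y)%g = (f x * f y)%g)
    & f @` S = S].

End Groups.

Section OrthogonalGroup.

Variables (R : realType) (E : lmodType R) (form : {symmetric E}).

Definition is_orthogonal (f : E -> E) : Prop :=
  [/\ linear f, bijective f & forall u v, form (f u) (f v) = form u v].

Record orthogonal_group := Orthogonal {
  orth_fun :> E -> E;
  orth_prop : is_orthogonal orth_fun }.

Lemma orthP (f g : orthogonal_group) : (forall v, f v = g v) -> f = g.
Proof.
case: f g => [f fP] [g gP] /= /funext fg; case: _ / fg in gP *.
by congr Orthogonal; exact: Prop_irrelevance.
Qed.

Lemma orth_one_subproof : is_orthogonal idfun.
Proof. by split=> //; exists idfun. Qed.

Lemma orth_mul_subproof (f g : orthogonal_group) : is_orthogonal (f \o g).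
Proof.
case: f g => [f [fL fB fI]] [g [gL gB gI]] /=; split.
- by move=> a u v /=; rewrite gL fL.
- exact: bij_comp.
- by move=> u v /=; rewrite fI gI.
Qed.

Lemma orth_inv_exists (f : orthogonal_group) :
  exists g : orthogonal_group, cancel f g /\ cancel g f.
Proof.
case: f => [f [fL [g fK gK] fI]] /=.
have gP : is_orthogonal g.
  split; [move=> a u v|by exists f|move=> u v].
  - by apply: (can_inj fK); rewrite fL !gK.
  - by rewrite -fI !gK.
by exists (Orthogonal gP).
Qed.

Definition orth_one := Orthogonal orth_one_subproof.
Definition orth_mul f g := Orthogonal (orth_mul_subproof f g).
Definition orth_inv f := sval (cid (orth_inv_exists f)).

Lemma orth_mulA : associative orth_mul.
Proof. by move=> f g h; apply: orthP. Qed.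

Lemma orth_mul1 : left_id orth_one orth_mul.
Proof. by move=> f; apply: orthP. Qed.

Lemma orth_mulr1 : right_id orth_one orth_mul.
Proof. by move=> f; apply: orthP. Qed.

Lemma orth_mulV : left_inverse orth_one orth_inv orth_mul.
Proof.
by move=> f; apply: orthP => v; rewrite /orth_inv; case: cid => g [/= ->].
Qed.

Lemma orth_mulrV : right_inverse orth_one orth_inv orth_mul.
Proof.
by move=> f; apply: orthP => v; rewrite /orth_inv; case: cid => g [/= _ ->].
Qed.

HB.instance Definition _ := gen_eqMixin orthogonal_group.
HB.instance Definition _ := gen_choiceMixin orthogonal_group.
HB.instance Definition _ := isGroup.Build orthogonal_group
  orth_mulA orth_mul1 orth_mulr1 orth_mulV orth_mulrV.

End OrthogonalGroup.

Section RootSystems.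

Variables (R : realType) (E : lmodType R) (form : {symmetric E}).
Implicit Types (Phi Pi A : set E) (W : set (orthogonal_group form)).

Definition COS : set R :=
  [set cos (pi / m%:R) | m in [set m : nat | (2 <= m)%N]]
  `|` [set x | 1 <= x].

Definition nonneg_cone A : set E :=
  [set v | exists (s : seq E) (c : E -> R),
     [/\ uniq s, (forall a, a \in s -> A a), (forall a, a \in s -> 0 <= c a)
       & v = \sum_(a <- s) c a *: a]].

Definition positively_independent A : Prop :=
  forall (s : seq E) (c : E -> R),
    uniq s -> (forall a, a \in s -> A a) -> (forall a, a \in s -> 0 <= c a) ->
    \sum_(a <- s) c a *: a = 0 -> forall a, a \in s -> c a = 0.

Definition reflection (a v : E) : E := v - (2 * form v a) *: a.

Lemma reflection_orthogonal (a : E) :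
  form a a = 1 -> is_orthogonal form (reflection a).
Proof.
move=> a1.
have fL : linear (reflection a).
  move=> k u v; rewrite /reflection linearPl /= mulrDr mulrCA scalerDl.
  by rewrite opprD addrACA scalerBr scalerA.
have fa : reflection a a = - a.
  by rewrite /reflection a1 mulr1 scaler_nat mulr2n opprD addNKr.
have fK : involutive (reflection a).
  move=> v; rewrite {2}/reflection addrC -scaleNr fL fa.
  by rewrite /reflection scaleNr scalerN opprK addrC subrK.
split=> //; first by exists (reflection a).
move=> u v; rewrite /reflection !linearBl !linearBr !linearZl_LR !linearZr_LR /=.
rewrite a1 (hermC form a v) /= expr0 !mul1r.
by ring.
Qed.

(* The set of the [s_a], [a] in [A], as elements of the orthogonal group. When
   [form a a = 1] exactly one [w] has [reflection a] as underlying map, by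
   [reflection_orthogonal] and [orthP]; the definition is only used for sets
   [A] of such vectors. *)
Definition reflections A : set (orthogonal_group form) :=
  [set w | exists2 a, A a & (w : E -> E) = reflection a].

Definition reflection_group A : set (orthogonal_group form) :=
  generated (reflections A).

Definition orbit_set W A : set E :=
  [set (w : E -> E) a | w in W & a in A].

Definition based_root_system Phi Pi : Prop :=
  [/\ positively_independent Pi,
      (forall a, Pi a -> form a a = 1),
      (forall a b, Pi a -> Pi b -> a <> b -> (-%R @` COS) (form a b))
    & Phi = orbit_set (reflection_group Pi) Pi].

Definition associated_coxeter_system Pi W
    (S : set (orthogonal_group form)) : Prop :=
  [/\ S = reflections Pi, W = reflection_group Pi & coxeter_system W S].

Definition positive_roots Phi Pi : set E := Phi `&` nonneg_cone Pi.

Definition root_system_automorphism Phi Pi (w : orthogonal_group form) : Prop :=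
  set_bij Pi Pi w /\ set_bij Phi Phi w.

Definition fundamental_chamber Pi : set E :=
  [set rho | forall a, Pi a -> 0 <= form a rho].

Definition tits_cone Pi : set E :=
  orbit_set (reflection_group Pi) (fundamental_chamber Pi).

End RootSystems.

Arguments reflections {R E} form A.
Arguments reflection_group {R E} form A.

(* Main.v *)
Require Import Defs.
From mathcomp Require Import all_boot all_order all_algebra.
From mathcomp Require Import boolp classical_sets functions reals trigo.
From mathcomp Require Import ring lra zify.

Set Implicit Arguments.
Unset Strict Implicit.
Unset Printing Implicit Defensive.

Import Order.TTheory GRing.Theory Num.Theory.

Local Open Scope classical_set_scope.
Local Open Scope ring_scope.

(** The theorem compares reflection groups through the cones spanned by their
simple roots; here a simple system is the set Pi of a based root system, and a
root is positive if it lies in the cone of Pi.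

Everything rests on one fact about a simple system [Pi] with group [W]: if a
word [x] in [Pi] is a shortest expression of the element it represents, and
appending the letter [a] does not give a shorter element, then [x] sends [a]
into the cone of [Pi] ([ascent_pos]). By splitting off the longest tail of [x]
in [a] and its last letter [b], this reduces to a dihedral group, where the
coefficients are Chebyshev polynomials of the second kind at [- form a b].
The fact is proved for any group whose generators satisfy the Coxeter relations
and which acts on E through the reflections. It then has four consequences.
Every root is positive or negative, and a nontrivial element makes some simple
root negative. Applied to a subgroup of the product of the orthogonal group with
a group K, the latter says that relations valid in [W] hold in K, which is the
universal property of a Coxeter system ([simple_system_coxeter]). For [v] in the fundamental chamber,
[v - w v] is in the cone of [Pi], so the chamber meets each orbit at most once
([chamber_unique]). And the Tits cone consists of the vectors negative on
finitely many positive roots ([tits_coneP]), hence is a convex cone.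

Suppose that W' maps tPi into itself. Conjugation by W' permutes the reflections
in tPi, so W' normalises tW; an element of the intersection of W' and tW makes
no element of tPi negative, so it is trivial, and the product is semidirect.

(i) implies (ii): a simple root outside Delta stays positive under W'
([parabolic_pos]), because [simple_permutes] says that a simple reflection makes
negative no positive root other than its own. So all of Delta and tPi lies in
the cone of Pi, which gives positive independence; and a root of Pi outside
Delta has nonpositive products with Delta, which puts tPi in the opposite of the
Tits cone.

(ii) implies (i): take Pi to be Delta together with the elements of tPi in the
opposite of the chamber. For a in Delta and b among the latter, with
[k = - form a b >= 0], the vector [b' = b + 2k a] is in tPi, and
[form b' b = 1 - 2k^2]. Since tPi is a simple system, [2k^2 - 1] is in COS when
[k] is nonzero, and the half-angle formula puts [k] in COS.

Uniqueness of Pi is [chamber_unique]; the statement on positive roots is the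
convexity of the Tits cone. Finally, if a reflection in a root of Delta were
conjugate in W to an element of J, which lies in the normal subgroup tW, then it
would itself lie in the intersection of tW and W'. *)

(** * Cones and positive independence *)

Section Cones.

Variables (R : realType) (E : lmodType R).
Implicit Types (A B : set E) (u v : E).

Lemma cone0 A : nonneg_cone A 0.
Proof. by exists [::], (fun=> 0); rewrite big_nil. Qed.

Lemma cone_mem A a : A a -> nonneg_cone A a.
Proof.
move=> Aa; exists [:: a], (fun=> 1).
split=> //; first by move=> b; rewrite inE => /eqP->.
by rewrite big_seq1 scale1r.
Qed.

Lemma cone_scale A k v : 0 <= k -> nonneg_cone A v -> nonneg_cone A (k *: v).
Proof.
move=> k0 [s [c [us sA c0 ->]]]; exists s, (fun a => k * c a).
split=> // [a /c0|]; first exact: mulr_ge0.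
by rewrite scaler_sumr; apply: eq_bigr => a _; rewrite scalerA.
Qed.

(* Padding with zeros brings two combinations to a common support. *)
Let extend (s t : seq E) (c : E -> R) : uniq s -> uniq t -> {subset s <= t} ->
  \sum_(a <- s) c a *: a = \sum_(a <- t) (if a \in s then c a else 0) *: a.
Proof.
move=> us ut st; transitivity (\sum_(a <- t | a \in s) c a *: a).
  rewrite -[RHS]big_filter; apply: perm_big; apply: uniq_perm => //.
    exact: filter_uniq.
  by move=> a; rewrite mem_filter; case as_: (a \in s) => //=; rewrite st.
by rewrite big_mkcond; apply: eq_bigr => a _; case: ifP; rewrite ?scale0r.
Qed.

Let merge A u v : nonneg_cone A u -> nonneg_cone A v ->
  exists s (c d : E -> R),
  [/\ uniq s, (forall a, a \in s -> A a), (forall a, 0 <= c a /\ 0 <= d a),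
      u = \sum_(a <- s) c a *: a & v = \sum_(a <- s) d a *: a].
Proof.
move=> [s [c [us sA c0 ->]]] [t [d [ut tA d0 ->]]].
exists (undup (s ++ t)), (fun a => if a \in s then c a else 0),
  (fun a => if a \in t then d a else 0).
split; first exact: undup_uniq.
- by move=> a; rewrite mem_undup mem_cat => /orP[/sA|/tA].
- by move=> a; split; [case: ifP => [/c0|]|case: ifP => [/d0|]].
- by apply: extend; rewrite ?undup_uniq// => a; rewrite mem_undup mem_cat => ->.
- apply: extend; rewrite ?undup_uniq// => a.
  by rewrite mem_undup mem_cat => ->; rewrite orbT.
Qed.

Lemma coneD A u v : nonneg_cone A u -> nonneg_cone A v -> nonneg_cone A (u + v).
Proof.
move=> Au Av; have [s [c [d [us sA cd0 -> ->]]]] := merge Au Av.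
exists s, (fun a => c a + d a); split=> // [a _|].
  by have [? ?] := cd0 a; rewrite addr_ge0.
by rewrite -big_split; apply: eq_bigr => a _; rewrite scalerDl.
Qed.

Lemma cone_ind A (P : E -> Prop) :
  P 0 -> (forall k a v, 0 <= k -> A a -> P v -> P (k *: a + v)) ->
  forall v, nonneg_cone A v -> P v.
Proof.
move=> P0 PD _ [s [c [_ sA c0 ->]]].
elim: s sA c0 => [|a s IHs] sA c0; first by rewrite big_nil.
rewrite big_cons; apply: PD; [exact/c0/mem_head|exact/sA/mem_head|].
by apply: IHs => b bs; [apply: sA|apply: c0]; rewrite inE bs orbT.
Qed.

Lemma cone_sub A B : A `<=` nonneg_cone B -> nonneg_cone A `<=` nonneg_cone B.
Proof.
move=> AB; apply: cone_ind => [|k a v k0 /AB Ba Bv]; first exact: cone0.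
by apply: coneD => //; apply: cone_scale.
Qed.

Lemma coneS A B : A `<=` B -> nonneg_cone A `<=` nonneg_cone B.
Proof. by move=> AB; apply: cone_sub => a /AB/cone_mem. Qed.

Lemma cone_split A a v : nonneg_cone A v ->
  exists k x, [/\ 0 <= k, nonneg_cone (A `\ a) x & v = k *: a + x].
Proof.
move: v; apply: cone_ind => [|k b v k0 Ab [l [x [l0 Ax ->]]]].
  by exists 0, 0; rewrite scale0r addr0; split=> //; apply: cone0.
have [->|ba] := pselect (b = a).
  by exists (k + l), x; rewrite addr_ge0// scalerDl addrA.
exists l, (k *: b + x); split=> //; last by rewrite addrCA.
by apply: coneD => //; apply: cone_scale => //; apply: cone_mem.
Qed.

(** The two combinations add up to 0, so the sums of their coefficients vanish; a
sum of two nonnegative numbers vanishes only if both do. *)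
Lemma cone_pointed A v : positively_independent A ->
  nonneg_cone A v -> nonneg_cone A (- v) -> v = 0.
Proof.
move=> indA Av ANv; have [s [c [d [us sA cd0 vc vd]]]] := merge Av ANv.
have cd a : a \in s -> c a + d a = 0.
  apply: (indA s (fun a => c a + d a)) => // [b _|].
    by have [? ?] := cd0 b; rewrite addr_ge0.
  under eq_bigr do rewrite scalerDl.
  by rewrite big_split /= -vc -vd subrr.
rewrite vc big_seq big1// => a /cd/eqP; have [c0 d0] := cd0 a.
by rewrite paddr_eq0// => /andP[/eqP-> _]; rewrite scale0r.
Qed.

Lemma posindepS A B : A `<=` B ->
  positively_independent B -> positively_independent A.
Proof. by move=> AB indB s c us sA; apply: indB => // a /sA/AB. Qed.

Lemma posindep_neq0 A a : positively_independent A -> A a -> a <> 0.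
Proof.
move=> indA Aa a0; move/eqP: (@oner_neq0 R); apply.
apply: (indA [:: a] (fun=> 1) _ _ _ _ a); rewrite ?mem_head//.
  by move=> b; rewrite inE => /eqP->.
by rewrite big_seq1 a0 scaler0.
Qed.

(** Each term of a vanishing nonnegative combination has its opposite in the cone
of [B], because the opposite is the sum of the other terms. *)
Lemma posindep_sub_cone A B : positively_independent B ->
  A `<=` nonneg_cone B -> (forall a, A a -> a <> 0) -> positively_independent A.
Proof.
move=> indB AB A0 s c us sA c0 sum0 a as_.
have /eqP : c a *: a = 0.
  apply: (cone_pointed indB).
    by apply: cone_scale; [exact: c0|apply/AB/sA].
  move/eqP: sum0; rewrite (bigD1_seq a)//= addr_eq0 => /eqP->; rewrite opprK.
  rewrite big_seq_cond; elim/big_ind: _ => [|u v|b /andP[bs _]].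
  - exact: cone0.
  - exact: coneD.
  - by apply: cone_scale; [exact: c0|apply/AB/sA].
by rewrite scaler_eq0 => /orP[/eqP//|/eqP/(A0 _ (sA _ as_))].
Qed.

End Cones.

(** * Chebyshev polynomials *)

Section Chebyshev.

Variable R : realType.
Implicit Types (c t : R) (k m : nat).

(** The Chebyshev polynomials of the second kind at [c], shifted so that
[cheb c 0 = 0]; they are the coefficients of the images of a simple root under
a dihedral group. *)
Fixpoint cheb c k : R :=
  if k is j.+1 then
    if j is i.+1 then 2 * c * cheb c j - cheb c i else 1
  else 0.

Lemma chebSS c k : cheb c k.+2 = 2 * c * cheb c k.+1 - cheb c k.
Proof. by []. Qed.

Lemma cheb_ge0 c k : 1 <= c -> 0 <= cheb c k.
Proof.
move=> c1; suff: 0 <= cheb c k <= cheb c k.+1 by case/andP.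
elim: k => [|k /andP[U0 U1]]; first by rewrite /= lexx ler01.
by rewrite chebSS; apply/andP; split; nra.
Qed.

(** This evaluates [cheb] at a cosine, hence gives its sign up to index [m] and
its period for the angle [pi / m]. *)
Lemma sin_cheb t k : sin t * cheb (cos t) k = sin (k%:R * t).
Proof.
elim/ltn_ind: k => -[|[|k]] IHk; first by rewrite mulr0 mul0r sin0.
  by rewrite mulr1 mul1r.
rewrite chebSS mulrBr mulrCA !IHk//.
have -> : k.+2%:R * t = k.+1%:R * t + t by rewrite -natr1 mulrDl mul1r.
have -> : k%:R * t = k.+1%:R * t - t by rewrite -natr1 mulrDl mul1r addrK.
by rewrite sinB sinD; ring.
Qed.

Variable m : nat.
Hypothesis m_ge2 : (2 <= m)%N.

Let t : R := pi / m%:R.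

Let m_gt0 : 0 < m%:R :> R. Proof. by rewrite ltr0n ltnW. Qed.

Let mt : m%:R * t = pi. Proof. by rewrite mulrC divfK ?gt_eqF. Qed.

Lemma sin_pi_div_gt0 : 0 < sin t.
Proof.
apply: sin_gt0_pi; rewrite divr_gt0 ?pi_gt0//= ltr_pdivrMr// ltr_pMr ?pi_gt0//.
by rewrite ltr1n.
Qed.

Lemma cos_pi_div_sqr_lt1 : cos t ^+ 2 < 1.
Proof. by have := sin_pi_div_gt0; have := cos2Dsin2 t; nra. Qed.

Lemma cheb_finite_ge0 k : (k <= m)%N -> 0 <= cheb (cos t) k.
Proof.
move=> km; rewrite -(pmulr_rge0 _ sin_pi_div_gt0) sin_cheb sin_ge0_pi//.
have t0 : 0 <= t by rewrite divr_ge0 ?pi_ge0.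
by rewrite mulr_ge0//= -mt ler_wpM2r// ler_nat.
Qed.

Let cheb_double_sin k (x : R) : k%:R * t = pi *+ 2 + x * t ->
  sin t * cheb (cos t) k = sin (x * t).
Proof. by move=> kx; rewrite sin_cheb kx addrC sinD2pi. Qed.

Let sin_inj (x y : R) : sin t * x = sin t * y -> x = y.
Proof. by apply: mulfI; rewrite gt_eqF// sin_pi_div_gt0. Qed.

Lemma cheb_double : cheb (cos t) m.*2 = 0.
Proof.
apply: sin_inj; rewrite (@cheb_double_sin _ 0) ?mul0r ?sin0 ?mulr0//.
by rewrite -mul2n natrM -mulrA mt addr0 mulr_natl.
Qed.

Lemma cheb_doubleS : cheb (cos t) m.*2.+1 = 1.
Proof.
apply: sin_inj; rewrite (@cheb_double_sin _ 1) ?mul1r ?mulr1//.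
by rewrite -natr1 -mul2n natrM mulrDl -mulrA mt mul1r mulr_natl.
Qed.

Lemma cheb_double_pred : cheb (cos t) m.*2.-1 = -1.
Proof.
apply: sin_inj; rewrite (@cheb_double_sin _ (-1)) ?mulN1r ?sinN ?mulrN1//.
have -> : m.*2.-1%:R = m.*2%:R - 1 :> R.
  by rewrite -subn1 natrB// double_gt0 ltnW.
by rewrite -mul2n natrM mulrBl -mulrA mt mul1r mulr_natl.
Qed.

End Chebyshev.

(** * Words in reflections *)

Section Words.

Variables (R : realType) (E : lmodType R) (form : {symmetric E}).
Implicit Types (a b u v : E) (x y : seq E).

Lemma form_sym u v : form u v = form v u.
Proof. by rewrite (hermC form u v) /= expr0 mul1r. Qed.

Lemma sformDl u v w : form (u + v) w = form u w + form v w.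
Proof. by rewrite linearDl. Qed.

Lemma sformZl k u v : form (k *: u) v = k * form u v.
Proof. by rewrite linearZl_LR. Qed.

Lemma sformNl u v : form (- u) v = - form u v.
Proof. by rewrite linearNl. Qed.

Lemma sformDr u v w : form w (u + v) = form w u + form w v.
Proof. by rewrite linearDr. Qed.

Lemma sformZr k u v : form v (k *: u) = k * form v u.
Proof. by rewrite linearZr_LR. Qed.

Lemma sformNr u v : form v (- u) = - form v u.
Proof. by rewrite linearNr. Qed.

Lemma reflectionD a u v :
  reflection form a (u + v) = reflection form a u + reflection form a v.
Proof. by rewrite /reflection sformDl mulrDr scalerDl opprD addrACA. Qed.

Lemma reflectionZ a k v : reflection form a (k *: v) = k *: reflection form a v.
Proof. by rewrite /reflection sformZl scalerBr scalerA mulrCA. Qed.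

Lemma reflectionN a v : reflection form a (- v) = - reflection form a v.
Proof. by rewrite -scaleN1r reflectionZ scaleN1r. Qed.

Lemma reflection_self a : form a a = 1 -> reflection form a a = - a.
Proof.
by move=> a1; rewrite /reflection a1 mulr1 scaler_nat mulr2n opprD addNKr.
Qed.

Lemma reflectionK a : form a a = 1 -> involutive (reflection form a).
Proof.
move=> a1 v; rewrite {2}/reflection reflectionD reflectionN reflectionZ.
by rewrite reflection_self// scalerN opprK /reflection subrK.
Qed.

Definition act x v : E := foldr (reflection form) v x.

Lemma act_cat x y v : act (x ++ y) v = act x (act y v).
Proof. exact: foldr_cat. Qed.

Lemma act_rcons x a v : act (rcons x a) v = act x (reflection form a v).
Proof. by rewrite -cats1 act_cat. Qed.

Lemma actD x u v : act x (u + v) = act x u + act x v.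
Proof. by elim: x => //= a x ->; rewrite reflectionD. Qed.

Lemma actZ x k v : act x (k *: v) = k *: act x v.
Proof. by elim: x => //= a x ->; rewrite reflectionZ. Qed.

Lemma actN x v : act x (- v) = - act x v.
Proof. by rewrite -scaleN1r actZ scaleN1r. Qed.

Lemma act_fix x v : (forall a, a \in x -> form v a = 0) -> act x v = v.
Proof.
elim: x => //= a x IHx vx; rewrite IHx => [|b bx]; last first.
  by apply: vx; rewrite inE bx orbT.
by rewrite /reflection vx ?mem_head// mulr0 scale0r subr0.
Qed.

(** The alternating word of length [k] whose last letter, the first to act, is
[b]. *)
Fixpoint altword k a b : seq E :=
  if k is j.+1 then (if odd j then a else b) :: altword j a b else [::].

Lemma altword_rcons k a b : altword k.+1 a b = rcons (altword k b a) b.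
Proof.
elim: k => // k IHk; rewrite [LHS]/=.
rewrite -[_ :: altword k a b]/(altword k.+1 a b) IHk /=.
by case: odd.
Qed.

Lemma size_altword k a b : size (altword k a b) = k.
Proof. by elim: k => //= k ->. Qed.

Lemma altword_mem k a b c : c \in altword k a b -> c = a \/ c = b.
Proof.
elim: k => //= k IHk; rewrite inE => /orP[/eqP->|/IHk//].
by case: odd; [left|right].
Qed.

Lemma act_altword k a b : form a a = 1 -> form b b = 1 ->
  let U := cheb (- form a b) in
  act (altword k a b) a =
    if odd k then U k *: a + U k.+1 *: b else U k.+1 *: a + U k *: b.
Proof.
move=> a1 b1 U; have U0 : U 0 = 0 by []; have U1 : U 1 = 1 by [].
have US j : U j.+2 = 2 * - form a b * U j.+1 - U j by [].
clearbody U; elim: k => [|k IHk].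
  by rewrite /= U0 U1 scale1r scale0r addr0.
have e : 2 * - form a b * U k.+1 = - (U k.+1 * (2 * form a b)) by ring.
rewrite [LHS]/= IHk [odd k.+1]/=; case: ifP => _ /=;
  rewrite reflectionD !reflectionZ reflection_self// /reflection US;
  rewrite scalerBl e scaleNr scalerN scalerBr scalerA.
  by rewrite (form_sym b a) addrCA [RHS]addrC; congr (_ + _); rewrite addrC.
by rewrite addrA.
Qed.

(** The relation [(s_a s_b)^m = 1] of the orthogonal group. It holds on [a] and
[b] by the period of [cheb]; as the form is nondegenerate on their plane, any
[v] is the sum of a vector of the plane and of one orthogonal to it, which is
fixed. *)
Lemma act_altword_braid m a b v : (2 <= m)%N -> form a a = 1 -> form b b = 1 ->
  form a b = - cos (pi / m%:R) -> act (altword m.*2 a b) v = v.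
Proof.
move=> m2 a1 b1 ab; set c := cos _ in ab.
have odd_pred : odd m.*2.-1.
  by case: m m2 {ab c} => // n _; rewrite doubleS /= odd_double.
have fix_a : act (altword m.*2 a b) a = a.
  rewrite act_altword// odd_double ab opprK cheb_double// cheb_doubleS//.
  by rewrite scale1r scale0r addr0.
have fix_b : act (altword m.*2 a b) b = b.
  rewrite -[in X in altword X](@prednK m.*2) ?double_gt0 1?ltnW//.
  rewrite altword_rcons act_rcons.
  rewrite reflection_self// actN act_altword// odd_pred form_sym ab opprK.
  rewrite prednK ?double_gt0 1?ltnW// cheb_double// cheb_double_pred//.
  by rewrite scale0r addr0 scaleN1r opprK.
have d0 : 1 - c ^+ 2 != 0 by rewrite subr_eq0 gt_eqF// cos_pi_div_sqr_lt1.
(* [l] and [r] solve the equations making [w] orthogonal to [a] and [b]. *)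
pose p := form v a; pose q := form v b.
pose l := (p + c * q) / (1 - c ^+ 2); pose r := (q + c * p) / (1 - c ^+ 2).
pose w := v - (l *: a + r *: b).
have wa : form w a = 0.
  rewrite /w sformDl sformNl sformDl !sformZl a1 (form_sym b a) ab -/p /l /r.
  by field.
have wb : form w b = 0.
  rewrite /w sformDl sformNl sformDl !sformZl b1 ab -/q /l /r.
  by field.
have -> : v = w + (l *: a + r *: b) by rewrite subrK.
clearbody w.
rewrite !actD !actZ fix_a fix_b.
by rewrite act_fix// => e /altword_mem[]->.
Qed.

End Words.

(** * Shortest words and positivity *)

Lemma exists_minimal_nat (Q : nat -> Prop) : (exists n, Q n) ->
  exists n, Q n /\ forall m, Q m -> (n <= m)%N.
Proof.
move=> exQ; have exb : exists n, `[< Q n >].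
  by case: exQ => n Qn; exists n; apply/asboolP.
case: (ex_minnP exb) => n /asboolP Qn minn; exists n.
by split=> // m /asboolP/minn.
Qed.

Section Lift.

Variables (R : realType) (E : lmodType R) (form : {symmetric E}).
Implicit Types (a b u v : E) (x y : seq E) (Pi : set E).

(** The part of [based_root_system] that speaks of [Pi] only. *)
Definition simple_system Pi : Prop :=
  [/\ positively_independent Pi, (forall a, Pi a -> form a a = 1)
    & forall a b, Pi a -> Pi b -> a <> b -> (-%R @` @COS R) (form a b)].

Definition word Pi x : Prop := forall a, a \in x -> Pi a.

Lemma word_cons Pi a x : word Pi (a :: x) <-> Pi a /\ word Pi x.
Proof.
split=> [Pix|[Pia Pix] b].
  by split=> [|b bx]; apply: Pix; rewrite inE ?eqxx ?bx ?orbT.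
by rewrite inE => /orP[/eqP->|/Pix].
Qed.

Lemma word_cat Pi x y : word Pi (x ++ y) <-> word Pi x /\ word Pi y.
Proof.
split=> [Pixy|[Pix Piy] a]; last by rewrite mem_cat => /orP[/Pix|/Piy].
by split=> a a_; apply: Pixy; rewrite mem_cat a_ ?orbT.
Qed.

Lemma word_seq1 Pi a : Pi a -> word Pi [:: a].
Proof. by move=> Pia b; rewrite inE => /eqP->. Qed.

Lemma word_rcons Pi x a : word Pi (rcons x a) <-> word Pi x /\ Pi a.
Proof.
rewrite -cats1 word_cat; split=> -[Pix Pia]; split=> //.
  by apply: Pia; rewrite inE.
by move=> b; rewrite inE => /eqP->.
Qed.

Lemma word_altword Pi k a b : Pi a -> Pi b -> word Pi (altword k a b).
Proof. by move=> Pia Pib c /altword_mem[]->. Qed.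

Definition wprod (T : groupType) (h : E -> T) x : T := (\prod_(a <- x) h a)%g.

Variables (Pi : set E) (T : groupType) (h : E -> T).

Lemma wprod_nil : wprod h [::] = 1%g.
Proof. exact: big_nil. Qed.

Lemma wprod_cons a x : wprod h (a :: x) = (h a * wprod h x)%g.
Proof. exact: big_cons. Qed.

Lemma wprod_cat x y : wprod h (x ++ y) = (wprod h x * wprod h y)%g.
Proof. exact: big_cat. Qed.

Lemma wprod_rcons x a : wprod h (rcons x a) = (wprod h x * h a)%g.
Proof. by rewrite -cats1 wprod_cat wprod_cons wprod_nil mulg1. Qed.

Lemma wprod_altword_expg m a b :
  wprod h (altword m.*2 a b) = ((h a * h b) ^+ m)%g.
Proof.
elim: m => [|m IHm]; first by rewrite expg0 wprod_nil.
by rewrite doubleS expgS -IHm /= odd_double /= !wprod_cons mulgA.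
Qed.

(* The [h a] satisfy the Coxeter relations and generate a group that acts on [E]
through the reflections. Faithfulness of the action is [wprod_faithful]. *)
Hypothesis simple_Pi : simple_system Pi.
Hypothesis h_act : forall x y, word Pi x -> word Pi y ->
  wprod h x = wprod h y -> act form x =1 act form y.
Hypothesis h_sq : forall a, Pi a -> (h a * h a = 1)%g.
Hypothesis h_braid : forall a b m, Pi a -> Pi b -> (2 <= m)%N ->
  form a b = - cos (pi / m%:R) -> ((h a * h b) ^+ m = 1)%g.

Let indPi : positively_independent Pi. Proof. by case: simple_Pi. Qed.
Let norm1 a : Pi a -> form a a = 1.
Proof. by case: simple_Pi => _ + _; apply. Qed.

Definition reduced x : Prop :=
  forall y, word Pi y -> wprod h y = wprod h x -> (size x <= size y)%N.

(** For a reduced [x]: appending [a] does not decrease the length of the element.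
Allowing equality avoids the parity of the length. *)
Definition ascent x a : Prop :=
  forall y, word Pi y -> wprod h y = wprod h (rcons x a) ->
    (size x <= size y)%N.

Lemma reduced_ex x : word Pi x ->
  exists y, [/\ word Pi y, wprod h y = wprod h x & reduced y].
Proof.
move=> Pix; have [|n [[y [Piy yx sy]] minn]] := @exists_minimal_nat (fun n =>
    exists y, [/\ word Pi y, wprod h y = wprod h x & size y = n]).
  by exists (size x), x.
exists y; split=> // z Piz zy; rewrite sy; apply: minn.
by exists z; rewrite zy.
Qed.

Lemma reduced_catl x y : word Pi y -> reduced (x ++ y) -> reduced x.
Proof.
move=> Piy red z Piz zx; have := red (z ++ y).
rewrite !wprod_cat zx word_cat !size_cat leq_add2r; exact.
Qed.

Lemma reduced_belast x a : Pi a -> reduced (rcons x a) -> reduced x.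
Proof.
by move=> Pia; rewrite -cats1; apply: reduced_catl; apply: word_seq1.
Qed.

Lemma wprod_rconsK x a : Pi a -> wprod h (rcons (rcons x a) a) = wprod h x.
Proof. by move=> Pia; rewrite !wprod_rcons -mulgA h_sq// mulg1. Qed.

Lemma reduced_rcons_ascent x a : Pi a -> reduced (rcons x a) -> ascent x a.
Proof.
by move=> Pia red y Piy /red-/(_ Piy); rewrite size_rcons; exact: ltnW.
Qed.

(** Two equal adjacent letters cancel, and a last letter [a] would be cancelled by
the appended one; so the letters alternate and the last is [b]. *)
Lemma reduced_altword x a b : Pi a -> Pi b ->
  (forall c, c \in x -> c = a \/ c = b) ->
  reduced x -> ascent x a -> x = altword (size x) a b.
Proof.
elim/last_ind: x a b => // x c IHx a b Pia Pib xab red asc.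
have Pix : word Pi x.
  by move=> e ex; case: (xab e); rewrite ?mem_rcons ?inE ?ex ?orbT// => ->.
have [ca|cb] : c = a \/ c = b by apply: xab; rewrite mem_rcons mem_head.
  have := asc x Pix; rewrite ca wprod_rconsK// size_rcons ltnn => H.
  by have := H erefl.
rewrite cb size_rcons altword_rcons -IHx//.
- move=> e ex; suff [->|->] : e = a \/ e = b by [right|left].
  by apply: xab; rewrite mem_rcons inE ex orbT.
- by apply: (@reduced_belast x b) => //; rewrite -cb.
- by apply: reduced_rcons_ascent => //; rewrite -cb.
Qed.

Section Braid.

Variables (a b : E) (m : nat).
Hypotheses (Pia : Pi a) (Pib : Pi b) (m_ge2 : (2 <= m)%N).
Hypothesis ab : form a b = - cos (pi / m%:R).

Let wprod_altword_double : wprod h (altword m.*2 a b) = 1%g.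
Proof. by rewrite wprod_altword_expg h_braid. Qed.

(** The two ways around a polygon with [2 m] sides. *)
Lemma wprod_altword i j : (i + j = m.*2)%N ->
  wprod h (altword j b a) = wprod h (altword i a b).
Proof.
elim: j i => [|j IHj] i.
  by rewrite addn0 => ->; rewrite wprod_altword_double wprod_nil.
move=> ijm; have /IHj : (i.+1 + j = m.*2)%N by rewrite -ijm addnS.
have oij : odd i = ~~ odd j.
  by have := congr1 odd ijm; rewrite odd_double oddD /=; do 2![case: odd].
by rewrite /= !wprod_cons oij => ->; case: odd; rewrite /= mulgA h_sq// mul1g.
Qed.

(** With the appended [a], the alternating word has [k.+1 > m] letters; going the
other way around the polygon replaces the last [m + 1] of them by [m - 1]. *)
Lemma altword_not_ascent k : (m <= k)%N -> ~ ascent (altword k a b) a.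
Proof.
move=> mk asc; have [y [Piy yk sy]] : exists y,
    [/\ word Pi y, wprod h y = wprod h (altword k.+1 b a) & (size y < k)%N].
  elim: k mk {asc} => [|k IHk]; first by rewrite leqNgt ltnW.
  rewrite leq_eqVlt => /orP[/eqP mk|/IHk[y [Piy yk sy]]].
    exists (altword k a b); rewrite size_altword leqnn; split=> //.
      exact: word_altword.
    by apply/esym/wprod_altword; lia.
  exists ((if odd k.+1 then b else a) :: y); split=> //.
    by rewrite word_cons; split=> //; case: odd.
  by rewrite wprod_cons yk -wprod_cons.
have := asc y Piy; rewrite -altword_rcons yk size_altword leqNgt sy.
by move/(_ erefl).
Qed.

End Braid.

Lemma cheb_altword_ge0 k a b : Pi a -> Pi b -> a <> b ->
  ascent (altword k a b) a ->
  0 <= cheb (- form a b) k /\ 0 <= cheb (- form a b) k.+1.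
Proof.
move=> Pia Pib a_b asc; have [_ _ /(_ a b Pia Pib a_b)] := simple_Pi.
case=> c [[m m2 <-]|c1] /esym ab; rewrite ab opprK; last by rewrite !cheb_ge0.
have km : (k < m)%N.
  rewrite ltnNge; apply/negP => mk.
  exact: (altword_not_ascent Pia Pib m2 ab mk asc).
by split; apply: cheb_finite_ge0 => //; exact: ltnW.
Qed.

(** Write [x] as [y ++ z] up to the relations, with [z] a word in [a] and in the
last letter [b] of [x], and with [y] as short as possible. Then neither [a] nor
[b] can be cancelled at the end of [y], so by induction [y] sends both into the
cone; and [z] alternates, so it sends [a] to a combination of [a] and [b] with
coefficients given by [cheb], nonnegative by [cheb_altword_ge0]. *)
Lemma ascent_pos x a : word Pi x -> Pi a -> reduced x -> ascent x a ->
  nonneg_cone Pi (act form x a).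
Proof.
move: {2}(size x) (erefl (size x)) => n; elim/ltn_ind: n x a => n IHn.
move=> x a nx Pix Pia redx ascx; case/lastP: x => [|x' b] in nx Pix redx ascx *.
  exact: cone_mem.
have [Pix' Pib] := (word_rcons _ _ _).1 Pix.
have a_b : a <> b.
  move=> ab; have := ascx x' Pix'; rewrite ab wprod_rconsK// size_rcons ltnn.
  by move/(_ erefl).
set x := rcons x' b in nx Pix redx ascx *.
pose Q k := exists y z, [/\ word Pi y, (forall c, c \in z -> c = a \/ c = b),
  wprod h (y ++ z) = wprod h x, size (y ++ z) = size x & size y = k].
have Q_x' : Q (size x').
  exists x', [:: b]; rewrite cats1 -/x; split=> //.
  by move=> c; rewrite inE => /eqP->; right.
have [|k [[y [z [Piy zab yzx size_yz yk]]] mink]] := @exists_minimal_nat Q.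
  by exists (size x').
have Piz : word Pi z by move=> c /zab[]->.
have Piyz : word Pi (y ++ z) by rewrite word_cat.
have red_yz : reduced (y ++ z).
  by move=> w Piw; rewrite yzx size_yz; exact: redx.
have redy : reduced y by apply: reduced_catl red_yz.
have k_x : (k < size x)%N by rewrite size_rcons ltnS; apply: mink.
(* Otherwise a letter [c] could be split off the end of [y] and put in front
   of [z]. *)
have ascy c : c = a \/ c = b -> ascent y c.
  move=> cab w Piw; have Pic : Pi c by case: cab => ->.
  rewrite wprod_rcons => wy; rewrite leqNgt; apply/negP => w_y.
  have wcz : wprod h (w ++ c :: z) = wprod h x.
    rewrite wprod_cat wprod_cons mulgA wy -(mulgA (wprod h y)) h_sq// mulg1.
    by rewrite -wprod_cat.
  have Picz : word Pi (c :: z) by rewrite word_cons.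
  have size_wcz : size (w ++ c :: z) = size x.
    apply/eqP; rewrite eqn_leq redx ?word_cat// andbT -size_yz !size_cat /=.
    by rewrite addnS -addSn leq_add2r.
  have : (k <= size w)%N.
    apply: mink; exists w, (c :: z); split=> // e.
    by rewrite inE => /orP[/eqP->|/zab].
  by rewrite -yk leqNgt w_y.
have redz : reduced z.
  move=> w Piw wz; have := red_yz (y ++ w).
  by rewrite !wprod_cat wz word_cat !size_cat leq_add2l; apply.
have ascz : ascent z a.
  move=> w Piw wz; have := ascx (y ++ w).
  rewrite wprod_rcons -yzx !wprod_cat wz wprod_rcons mulgA word_cat -size_yz.
  by rewrite !size_cat leq_add2l; apply.
have z_alt := reduced_altword Pia Pib zab redz ascz.
have posy c : c = a \/ c = b -> nonneg_cone Pi (act form y c).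
  move=> cab; apply: (IHn k) => //; first by rewrite -nx.
    by case: cab => ->.
  exact: ascy.
rewrite -(h_act Piyz Pix yzx) act_cat z_alt act_altword; [|exact: norm1..].
have [U0 U1] : 0 <= cheb (- form a b) (size z) /\
    0 <= cheb (- form a b) (size z).+1.
  by apply: cheb_altword_ge0; rewrite -?z_alt.
by case: odd; rewrite actD !actZ; apply: coneD; apply: cone_scale => //;
  apply: posy; [left|right|left|right].
Qed.

Lemma reduced_rcons_neg x a : word Pi (rcons x a) -> reduced (rcons x a) ->
  nonneg_cone Pi (act form x a) /\ nonneg_cone Pi (- act form (rcons x a) a).
Proof.
move=> /word_rcons[Pix Pia] red.
suff pos : nonneg_cone Pi (act form x a).
  by split=> //; rewrite act_rcons reflection_self ?norm1// actN opprK.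
apply: ascent_pos => //; last exact: reduced_rcons_ascent.
exact: reduced_belast red.
Qed.

Lemma descent_ex x : word Pi x -> wprod h x <> 1%g ->
  exists2 a, Pi a & nonneg_cone Pi (- act form x a).
Proof.
move=> Pix x1; have [y [Piy yx red]] := reduced_ex Pix.
case/lastP: y => [|y a] in Piy yx red; first by case: x1; rewrite -yx wprod_nil.
have [_ neg] := reduced_rcons_neg Piy red.
exists a; first by case/word_rcons: Piy.
by rewrite -(h_act Piy Pix yx).
Qed.

Lemma wprod_faithful x : word Pi x -> act form x =1 id -> wprod h x = 1%g.
Proof.
move=> Pix xid; apply: contrapT => /(descent_ex Pix)[a Pia].
rewrite xid => /(cone_pointed indPi (cone_mem Pia)) a0.
exact: (posindep_neq0 indPi Pia).
Qed.

(** So the subgroup generated by the [h a] maps isomorphically onto the reflection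
group. *)
Lemma wprod_act_inj x y : word Pi x -> word Pi y -> act form x =1 act form y ->
  wprod h x = wprod h y.
Proof.
move=> Pix Piy xy.
have Piry : word Pi (rev y) by move=> a; rewrite mem_rev => /Piy.
have wrevK z : word Pi z -> (wprod h (rev z) * wprod h z = 1)%g.
  elim: z => [|a z IHz] /=; first by rewrite wprod_nil mulg1.
  move=> /word_cons[Pia /IHz {}IHz]; rewrite rev_cons wprod_rcons wprod_cons.
  by rewrite mulgA -(mulgA (wprod h (rev z))) h_sq// mulg1.
have arevK z v : word Pi z -> act form (rev z) (act form z v) = v.
  elim: z v => //= a z IHz v /word_cons[Pia /IHz {}IHz].
  by rewrite rev_cons act_rcons reflectionK ?norm1.
have := @wprod_faithful (rev y ++ x); rewrite word_cat wprod_cat => H.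
apply: (mulgI (wprod h (rev y))); rewrite wrevK// H//.
by move=> v; rewrite act_cat xy arevK.
Qed.

(** If [a] shortens [x], then [a] is an ascent of a reduced word [z] for the
element of [x a], and [x] and [z] send [a] to opposite vectors. *)
Lemma root_sign x a : word Pi x -> Pi a ->
  nonneg_cone Pi (act form x a) \/ nonneg_cone Pi (- act form x a).
Proof.
move=> Pix Pia; have [y [Piy yx red]] := reduced_ex Pix.
rewrite -(h_act Piy Pix yx); have [asc|] := pselect (ascent y a).
  by left; apply: ascent_pos.
move=> /existsNP[z /not_implyP[Piz /not_implyP[zya /negP]]].
rewrite -ltnNge => zy.
have Piya : word Pi (rcons y a) by rewrite word_rcons.
have Piza : word Pi (rcons z a) by rewrite word_rcons.
have zay : wprod h (rcons z a) = wprod h y.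
  by rewrite wprod_rcons zya wprod_rcons -mulgA h_sq// mulg1.
right; rewrite -(h_act Piza Piy zay).
have [] // := reduced_rcons_neg Piza.
move=> w Piw; rewrite zay size_rcons => /(red _ Piw); exact: leq_trans.
Qed.

(** Each new letter [a] of a reduced word subtracts a nonnegative multiple of the
image of [a] under the word before it, which is positive. *)
Lemma chamber_sub_act x v : word Pi x -> fundamental_chamber form Pi v ->
  nonneg_cone Pi (v - act form x v).
Proof.
move=> Pix Cv; have [y [Piy yx red]] := reduced_ex Pix.
rewrite -(h_act Piy Pix yx) {x Pix yx}.
elim/last_ind: y => [|x a IHx] in Piy red *.
  by rewrite subrr; apply: cone0.
have [pos _] := reduced_rcons_neg Piy red.
have [Pix Pia] := (word_rcons _ _ _).1 Piy.
have redx : reduced x.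
  exact: reduced_belast red.
rewrite act_rcons /reflection actD actN actZ opprB addrCA addrC; apply: coneD.
  exact: IHx.
by apply: cone_scale => //; rewrite form_sym mulr_ge0// Cv.
Qed.

End Lift.

(** * Generated subgroups and semidirect products *)

Section Groups.

Variable G : groupType.
Implicit Types (A N H : set G) (x y w : G).

Lemma generated_subgroup A : is_subgroup (generated A).
Proof.
split=> [|x y Ax Ay|x Ax] H [subH AH]; have [H1 HM HV] := subH => //.
  by apply: HM; [apply: Ax|apply: Ay].
by apply: HV; apply: Ax.
Qed.

Lemma generated_mem A x : A x -> generated A x.
Proof. exact: sub_gen_smallest. Qed.

Lemma generated_sub A H : is_subgroup H -> A `<=` H -> generated A `<=` H.
Proof. exact: smallest_sub. Qed.

Lemma generated_conj A w : (forall s, A s -> generated A (w * s * w^-1)%g) ->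
  forall x, generated A x -> generated A (w * x * w^-1)%g.
Proof.
move=> Aw; have [gen1 genM genV] := generated_subgroup A.
apply: (@generated_sub A [set x | generated A (w * x * w^-1)%g]) => //.
split=> /= [|x y|x].
- by rewrite mulg1 mulgV.
- by move=> wx wy; have := genM _ _ wx wy; rewrite !mulgA mulgVK.
- by move/genV; rewrite !invgM invgK mulgA.
Qed.

Lemma semidirect_generated N H : is_subgroup N -> is_subgroup H ->
  (forall h n, H h -> N n -> N (h * n * h^-1)%g) -> N `&` H = [set 1%g] ->
  semidirect (generated (H `|` N)) N H.
Proof.
move=> subN subH normN NH1.
have [N1 NM NV] := subN; have [H1 HM HV] := subH.
pose NH := [set (n * h)%g | n in N & h in H].
have subNH : is_subgroup NH.
  split.
  - by exists 1%g => //; exists 1%g => //; rewrite mulg1.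
  - move=> _ _ [n Nn [h Hh <-]] [m Nm [k Hk <-]].
    exists (n * (h * m * h^-1))%g; first by apply: NM => //; apply: normN.
    by exists (h * k)%g; [apply: HM|rewrite !mulgA mulgVK].
  - move=> _ [n Nn [h Hh <-]]; exists (h^-1 * n^-1 * h)%g.
      by rewrite -[X in (_ * X)%g]invgK; apply: normN; [apply: HV|apply: NV].
    by exists h^-1%g; [apply: HV|rewrite mulgK invgM].
have genE : generated (H `|` N) = NH.
  apply/seteqP; split.
    apply: generated_sub => // x [Hx|Nx].
      by exists 1%g => //; exists x => //; rewrite mul1g.
    by exists x => //; exists 1%g => //; rewrite mulg1.
  move=> _ [n Nn [h Hh <-]]; have [_ genM _] := generated_subgroup (H `|` N).
  by apply: genM; apply: generated_mem; [right|left].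
split=> //; rewrite genE => _ m [n Nn [h Hh <-]] Nm.
have -> : (n * h * m * (n * h)^-1 = n * (h * m * h^-1) * n^-1)%g.
  by rewrite invgM !mulgA.
by apply: (NM); [apply: NM => //; apply: normN|apply: NV].
Qed.

End Groups.

(** * Reflection groups are Coxeter groups *)

Section ReflectionGroup.

Variables (R : realType) (E : lmodType R) (form : {symmetric E}).
Local Notation O := (orthogonal_group form).
Implicit Types (a b u v : E) (w : O) (A Pi : set E) (x y : seq E).

Lemma orthD w u v : w (u + v) = w u + w v.
Proof. by have [wL _ _] := orth_prop w; rewrite -[u]scale1r wL !scale1r. Qed.

Lemma orthZ w k v : w (k *: v) = k *: w v.
Proof.
have [wL _ _] := orth_prop w; have w0 : w 0 = 0.
  by apply: (addrI (w 0)); rewrite -orthD !addr0.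
by rewrite -[k *: v]addr0 wL w0 addr0.
Qed.

Lemma orthN w v : w (- v) = - w v.
Proof. by rewrite -scaleN1r orthZ scaleN1r. Qed.

Lemma orth_form w u v : form (w u) (w v) = form u v.
Proof. by case: (orth_prop w). Qed.

Lemma orthM w1 w2 v : (w1 * w2)%g v = w1 (w2 v). Proof. by []. Qed.

Lemma orthKV w v : w (w^-1%g v) = v.
Proof. by rewrite -orthM mulgV. Qed.

Lemma orthVK w v : w^-1%g (w v) = v.
Proof. by rewrite -orthM mulVg. Qed.

Lemma orth_inj w : injective w.
Proof. exact: can_inj (orthVK w). Qed.

Lemma orth_formV w u v : form u (w v) = form (w^-1%g u) v.
Proof. by rewrite -(orth_form w^-1%g) orthVK. Qed.

(** The value 1 off the unit vectors only makes the function total. *)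
Definition refl a : O :=
  if pselect (form a a = 1) is left a1
  then Orthogonal (reflection_orthogonal a1) else 1%g.

Lemma reflE a v : form a a = 1 -> refl a v = reflection form a v.
Proof. by rewrite /refl; case: pselect. Qed.

Lemma reflxx a : form a a = 1 -> (refl a * refl a = 1)%g.
Proof.
by move=> a1; apply: orthP => v; rewrite orthM !reflE// reflectionK.
Qed.

Lemma reflV a : form a a = 1 -> (refl a)^-1%g = refl a.
Proof. by move=> a1; apply/(mulgI (refl a)); rewrite mulgV reflxx. Qed.

Lemma refl_conj w a : form a a = 1 -> (w * refl a * w^-1)%g = refl (w a).
Proof.
move=> a1; apply: orthP => v.
rewrite !orthM !reflE// ?orth_form// /reflection orthD orthN orthZ orthKV.
by rewrite (orth_formV w v a).
Qed.

Lemma refl_eq a b : form a a = 1 -> form b b = 1 -> refl a = refl b ->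
  a = b \/ a = - b.
Proof.
move=> a1 b1 ab; have := congr1 (fun w : O => w a) ab.
rewrite /= !reflE// reflection_self// /reflection; set k := form a b => aE.
clearbody k; have {}aE : a = k *: b.
  apply: (@scalerI _ _ (2 : R)); first by rewrite pnatr_eq0.
  rewrite scalerA; apply/eqP; rewrite -subr_eq0; apply/eqP.
  by rewrite scaler_nat mulr2n -addrA -aE subrr.
have /eqP : k * k = 1 by rewrite -a1 aE sformZl sformZr b1 mulr1.
rewrite -expr2 sqrf_eq1 aE => /orP[]/eqP->; [left|right].
  by rewrite scale1r.
by rewrite scaleN1r.
Qed.

Lemma refl_neq1 a : form a a = 1 -> refl a <> 1%g.
Proof.
move=> a1 /(congr1 (fun w : O => form (w a) a)).
rewrite reflE// reflection_self// sformNl a1 => /eqP.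
by rewrite -subr_eq0 -opprD oppr_eq0 (_ : 1 + 1 = 2%:R)// pnatr_eq0.
Qed.

Lemma reflectionsP A w : (forall a, A a -> form a a = 1) ->
  reflections form A w <-> exists2 a, A a & w = refl a.
Proof.
move=> A1; split=> -[a Aa wa]; exists a => //.
  by apply: orthP => v; rewrite wa reflE// A1.
by apply/funext => v; rewrite wa reflE// A1.
Qed.

Section SimpleSystem.

Variable Pi : set E.
Hypothesis simple_Pi : simple_system form Pi.

Let W := reflection_group form Pi.
Let indPi : positively_independent Pi. Proof. by case: simple_Pi. Qed.
Let norm1 a : Pi a -> form a a = 1.
Proof. by case: simple_Pi => _ + _; apply. Qed.

Lemma reflections_refl a : Pi a -> reflections form Pi (refl a).
Proof. by move=> Pia; apply/reflectionsP => //; exists a. Qed.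

Lemma refl_group a : Pi a -> W (refl a).
Proof. by move=> /reflections_refl/generated_mem. Qed.

Lemma wprod_refl x v : word Pi x -> wprod refl x v = act form x v.
Proof.
elim: x => [|a x IHx] => [_|/word_cons[Pia Pix]]; first by rewrite wprod_nil.
by rewrite wprod_cons orthM reflE ?norm1//= IHx.
Qed.

Lemma reflection_groupP w : W w <-> exists2 x, word Pi x & w = wprod refl x.
Proof.
have [W1 WM WV] := generated_subgroup (reflections form Pi).
split=> [|[x Pix ->]]; last first.
  elim: x Pix => [_|a x IHx /word_cons[Pia /IHx Wx]].
    by rewrite wprod_nil.
  by rewrite wprod_cons; apply: WM => //; apply: refl_group.
apply: (@generated_sub _ _ [set w | exists2 x, word Pi x & w = wprod refl x]).
  split.
  - by exists [::]; rewrite ?wprod_nil.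
  - move=> _ _ [x Pix ->] [y Piy ->].
    by exists (x ++ y); rewrite ?wprod_cat ?word_cat.
  - move=> _ [x Pix ->]; exists (rev x).
      by move=> a; rewrite mem_rev => /Pix.
    elim: x Pix => [_|a x IHx /word_cons[Pia /IHx IH]].
      by rewrite wprod_nil invg1.
    by rewrite rev_cons wprod_rcons -IH wprod_cons invgM reflV ?norm1.
move=> s /reflectionsP[]// a Pia ->.
by exists [:: a]; [apply: word_seq1|rewrite wprod_cons wprod_nil mulg1].
Qed.

Lemma wprod_refl_act x y : word Pi x -> word Pi y ->
  wprod refl x = wprod refl y -> act form x =1 act form y.
Proof. by move=> Pix Piy xy v; rewrite -!wprod_refl// xy. Qed.

Lemma refl_sq a : Pi a -> (refl a * refl a = 1)%g.
Proof. by move=> Pia; apply: reflxx; apply: norm1. Qed.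

Lemma refl_braid a b m : Pi a -> Pi b -> (2 <= m)%N ->
  form a b = - cos (pi / m%:R) -> ((refl a * refl b) ^+ m = 1)%g.
Proof.
move=> Pia Pib m2 ab; apply: orthP => v; rewrite -wprod_altword_expg.
rewrite wprod_refl ?(act_altword_braid _ m2)//; [exact: norm1..|].
exact: word_altword.
Qed.

Lemma group_root_sign w a : W w -> Pi a ->
  nonneg_cone Pi (w a) \/ nonneg_cone Pi (- w a).
Proof.
move=> /reflection_groupP[x Pix ->] Pia; rewrite wprod_refl//.
exact: (root_sign simple_Pi wprod_refl_act refl_sq refl_braid).
Qed.

Lemma group_descent w : W w -> w <> 1%g ->
  exists2 a, Pi a & nonneg_cone Pi (- w a).
Proof.
move=> /reflection_groupP[x Pix ->].
move=> /(descent_ex simple_Pi wprod_refl_act refl_sq refl_braid Pix)[a Pia].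
by rewrite -wprod_refl//; exists a.
Qed.

Lemma group_chamber_sub w v : W w -> fundamental_chamber form Pi v ->
  nonneg_cone Pi (v - w v).
Proof.
move=> /reflection_groupP[x Pix ->] Cv; rewrite wprod_refl//.
exact: (chamber_sub_act simple_Pi wprod_refl_act refl_sq refl_braid).
Qed.

(** The positivity theory for [a] sent to the pair of [refl a] and [f (refl a)]
shows that a word trivial on [E] has a trivial second component. So the value of
[f] along a word depends only on the element that the word represents. *)
Lemma simple_system_coxeter : coxeter_system W (reflections form Pi).
Proof.
split=> //.
  move=> _ /reflectionsP[]// a Pia ->.
  by split; [apply: refl_neq1|apply: refl_sq]; rewrite ?norm1.
move=> K f f_rel; pose h a : (O * K)%type := (refl a, f (refl a)).
have h1 x : (wprod h x).1 = wprod refl x.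
  by elim: x => [|a x IHx]; rewrite ?wprod_nil// !wprod_cons -IHx.
have h2 x : (wprod h x).2 = wprod (f \o refl) x.
  by elim: x => [|a x IHx]; rewrite ?wprod_nil// !wprod_cons -IHx.
have hE (p q : (O * K)%type) : p.1 = q.1 -> p.2 = q.2 -> p = q.
  by case: p q => [? ?] [? ?] /= -> ->.
have h_act x y : word Pi x -> word Pi y -> wprod h x = wprod h y ->
    act form x =1 act form y.
  by move=> Pix Piy xy; apply: wprod_refl_act => //; rewrite -!h1 xy.
have h_rel a b m : Pi a -> Pi b -> ((refl a * refl b) ^+ m = 1)%g ->
    ((h a * h b) ^+ m = 1)%g.
  move=> Pia Pib ab; rewrite -wprod_altword_expg; apply: hE.
    by rewrite h1 wprod_altword_expg.
  rewrite h2 wprod_altword_expg; apply: f_rel => //; exact: reflections_refl.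
have h_sq a : Pi a -> (h a * h a = 1)%g.
  by move=> Pia; rewrite -[LHS]expg1; apply: h_rel => //; rewrite expg1 refl_sq.
have h_braid a b m : Pi a -> Pi b -> (2 <= m)%N ->
    form a b = - cos (pi / m%:R) -> ((h a * h b) ^+ m = 1)%g.
  by move=> Pia Pib m2 ab; apply: h_rel => //; apply: refl_braid.
have [w|g gP] := @choice _ _ (fun (w : O) (k : K) => forall x, word Pi x ->
    wprod refl x = w -> wprod (f \o refl) x = k).
  have [[x [Pix xw]]|now] := pselect (exists x, word Pi x /\ wprod refl x = w).
    exists (wprod (f \o refl) x) => y Piy yw; rewrite -!h2.
    rewrite (wprod_act_inj simple_Pi h_act h_sq h_braid Piy Pix)//.
    by apply: wprod_refl_act => //; rewrite yw.
  by exists 1%g => y Piy yw; case: now; exists y.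
exists g; split.
  move=> _ _ /reflection_groupP[x Pix ->] /reflection_groupP[y Piy ->].
  rewrite -(gP _ x Pix erefl) -(gP _ y Piy erefl) -(gP _ (x ++ y)) ?wprod_cat//.
  by rewrite word_cat.
move=> _ /reflectionsP[]// a Pia ->; rewrite -(gP _ [:: a]).
- by rewrite wprod_cons wprod_nil mulg1.
- exact: word_seq1.
- by rewrite wprod_cons wprod_nil mulg1.
Qed.

End SimpleSystem.

End ReflectionGroup.

(** * Geometry of simple systems *)

Section Cosines.

Variable R : realType.

Lemma COS_ge0 (c : R) : @COS R c -> 0 <= c.
Proof.
case=> [[m m2 <-]|]; last exact: le_trans.
have m0 : 0 < m%:R :> R by rewrite ltr0n ltnW.
apply: cos_ge0_pihalf; apply/andP; split.
  by rewrite (@le_trans _ _ 0)// ?oppr_le0 divr_ge0 ?pi_ge0// ltW.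
by rewrite ler_pM2l ?pi_gt0// lef_pV2 ?posrE// ler_nat.
Qed.

(** Half-angle formula: [2 c^2 - 1 = cos (pi / m)] gives [c = cos (pi / (2 m))]. *)
Lemma COS_half (c : R) : 0 <= c -> @COS R (2 * c ^+ 2 - 1) -> @COS R c.
Proof.
move=> c0 [[m m2 m_c2]|]; last first.
  by move=> /= c2; right; rewrite /= -(@expr_ge1 _ 2)//; lra.
have m2' : (2 <= m.*2)%N by rewrite -addnn; apply: leq_trans m2 (leq_addr _ _).
have m0 : m%:R != 0 :> R by rewrite pnatr_eq0; case: (m) m2.
left; exists m.*2 => //; apply/eqP; rewrite -(@eqrXn2 _ 2)//; last first.
  by apply: COS_ge0; left; exists m.*2.
have := cos_mulr2n (pi / m.*2%:R : R).
have -> : (pi / m.*2%:R) *+ 2 = pi / m%:R :> R.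
  by rewrite -mul2n natrM -mulr_natl; field.
by rewrite m_c2 => ?; apply/eqP; lra.
Qed.

End Cosines.

Section Simple.

Variables (R : realType) (E : lmodType R) (form : {symmetric E}).
Variable Pi : set E.
Hypothesis simple_Pi : simple_system form Pi.
Implicit Types (a b u v : E).

Let W := reflection_group form Pi.
Let indPi : positively_independent Pi. Proof. by case: simple_Pi. Qed.
Let norm1 a : Pi a -> form a a = 1.
Proof. by case: simple_Pi => _ + _; apply. Qed.

Lemma simple_form_le0 a b : Pi a -> Pi b -> a <> b -> form a b <= 0.
Proof.
case: simple_Pi => _ _ H Pia Pib /(H _ _ Pia Pib)[c /COS_ge0 c0 <-].
by rewrite oppr_le0.
Qed.

Lemma simple_not_cone a : Pi a -> ~ nonneg_cone (Pi `\ a) a.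
Proof.
move=> Pia acone; have : form a a <= 0.
  apply: (@cone_ind _ _ (Pi `\ a) (fun v => form v a <= 0)) acone.
    by rewrite linear0l.
  move=> k b v k0 [Pib ba] v0; rewrite sformDl sformZl.
  by rewrite -[0]addr0 lerD// mulr_ge0_le0// simple_form_le0.
by rewrite norm1// ler10.
Qed.

(** The reflection in [a] changes only the coefficient on [a], and the other part
of a positive root different from [a] cannot vanish. As [Pi] need not be
linearly independent, comparing coefficients is replaced by [simple_not_cone]
and [cone_pointed]. *)
Lemma simple_permutes a b : Pi a -> form b b = 1 -> nonneg_cone Pi b ->
  nonneg_cone Pi (- reflection form a b) -> b = a.
Proof.
move=> Pia b1 /(@cone_split _ _ _ a)[k [x [k0 Px bE]]].
move=> /(@cone_split _ _ _ a)[l [y [l0 Py]]].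
set d := 2 * form b a => rbE.
have xyE : x + y = (d - k - l) *: a.
  have -> : (d - k - l) *: a = d *: a - (k *: a + l *: a).
    by rewrite -addrA scalerDl scalerDl !scaleNr opprD.
  have -> : d *: a = b + (l *: a + y) by rewrite -rbE opprB addrC subrK.
  by rewrite bE addrACA [RHS]addrC addKr.
have sub_cone z : nonneg_cone (Pi `\ a) z -> nonneg_cone Pi z.
  by apply: coneS => c [].
have [e0|e0] := ltP 0 (d - k - l).
  case: (simple_not_cone Pia).
  have aE : a = (d - k - l)^-1 *: (x + y).
    by rewrite xyE scalerA mulVf ?scale1r// gt_eqF.
  by rewrite {2}aE; apply: cone_scale; [rewrite invr_ge0 ltW|apply: coneD].
have x0 : x = 0.
  apply: (cone_pointed indPi); first exact: sub_cone.
  have -> : - x = y + (- (d - k - l)) *: a.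
    by rewrite scaleNr -xyE opprD addrCA subrr addr0.
  apply: coneD; first exact: sub_cone.
  by apply: cone_scale; [rewrite oppr_ge0|apply: cone_mem].
rewrite x0 addr0 in bE; suff k1 : k = 1 by rewrite bE k1 scale1r.
have /eqP : k * k = 1 by rewrite -b1 bE sformZl sformZr norm1// mulr1.
rewrite -expr2 sqrf_eq1 => /orP[]/eqP// kN1.
by move: k0; rewrite kN1 oppr_ge0 ler10.
Qed.

End Simple.

(** * The Tits cone and the fundamental chamber *)

Section TitsCone.

Variables (R : realType) (E : lmodType R) (form : {symmetric E}).
Variable Pi : set E.
Hypothesis simple_Pi : simple_system form Pi.
Implicit Types (a b u v : E) (w : orthogonal_group form).

Let W := reflection_group form Pi.
Let indPi : positively_independent Pi. Proof. by case: simple_Pi. Qed.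
Let norm1 a : Pi a -> form a a = 1.
Proof. by case: simple_Pi => _ + _; apply. Qed.
Let W1 : W 1%g. Proof. by case: (generated_subgroup (reflections form Pi)). Qed.
Let WM w1 w2 : W w1 -> W w2 -> W (w1 * w2)%g.
Proof. by case: (generated_subgroup (reflections form Pi)) => _ + _; apply. Qed.

Lemma simple_root a : Pi a -> orbit_set W Pi a.
Proof. by move=> Pia; exists 1%g => //; exists a. Qed.

Lemma root_norm1 b : orbit_set W Pi b -> form b b = 1.
Proof. by case=> w _ [a /norm1 a1 <-]; rewrite orth_form. Qed.

Lemma root_stable w b : W w -> orbit_set W Pi b -> orbit_set W Pi (w b).
Proof.
by move=> Ww [w' Ww' [a Pia <-]]; exists (w * w')%g; [apply: WM|exists a].
Qed.

Lemma root_pos_or_neg b : orbit_set W Pi b ->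
  nonneg_cone Pi b \/ nonneg_cone Pi (- b).
Proof. by case=> w Ww [a Pia <-]; exact: group_root_sign. Qed.

Lemma refl_root_pos a b : Pi a -> orbit_set W Pi b -> nonneg_cone Pi b ->
  b <> a -> nonneg_cone Pi (refl form a b).
Proof.
move=> Pia rb pb ba.
have [//|] := root_pos_or_neg (root_stable (refl_group simple_Pi Pia) rb).
rewrite reflE ?norm1//.
by move=> /(simple_permutes simple_Pi Pia (root_norm1 rb) pb).
Qed.

Lemma cone_chamber_ge0 b v :
  nonneg_cone Pi b -> fundamental_chamber form Pi v ->
  0 <= form b v.
Proof.
move=> pb Cv; apply: (@cone_ind _ _ Pi (fun b => 0 <= form b v)) pb.
  by rewrite linear0l.
by move=> k a u k0 Pia u0; rewrite sformDl sformZl addr_ge0// mulr_ge0// Cv.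
Qed.

(** Convexity of the Tits cone is visible on this characterisation. *)
Definition finitely_negative v : Prop := exists L : seq E,
  forall b, orbit_set W Pi b -> nonneg_cone Pi b -> form b v < 0 -> b \in L.

(** By [refl_root_pos], the reflection in [a] permutes the positive roots other
than [a]. *)
Lemma finitely_negative_refl a v : Pi a ->
  finitely_negative v -> finitely_negative (refl form a v).
Proof.
move=> Pia [L negL]; exists (a :: map (refl form a) L) => b rb pb.
rewrite orth_formV reflV ?norm1// => bv; rewrite inE.
have [->|/eqP ba] := eqVneq b a; first by [].
apply/mapP; exists (refl form a b); last by rewrite -orthM reflxx ?norm1.
apply: negL => //; last exact: refl_root_pos.
by apply: root_stable => //; apply: refl_group.
Qed.

(** If [v] is outside the chamber then it is negative on some simple [a], and
reflecting in [a] removes one root from those on which [v] is negative. *)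
Lemma tits_coneP v : tits_cone form Pi v <-> finitely_negative v.
Proof.
split=> [[w /(reflection_groupP simple_Pi)[x Pix ->] [c Cc <-]]|].
  elim: x Pix => [_|a x IHx /word_cons[Pia /IHx xc]]; last first.
    by rewrite wprod_cons orthM; apply: finitely_negative_refl.
  rewrite wprod_nil; exists [::] => b rb pb; rewrite ltNge.
  by rewrite cone_chamber_ge0.
case=> L; move: {2}(size L) (erefl (size L)) => n.
elim/ltn_ind: n v L => n IHn v L nL negL.
have [Cv|] := pselect (fundamental_chamber form Pi v).
  by exists 1%g => //; exists v.
move=> /existsNP[a /not_implyP[Pia /negP]]; rewrite -ltNge => av.
have aL : a \in L by apply: negL => //; [exact: simple_root|exact: cone_mem].
pose L' := [seq refl form a b | b <- L & b != a].
have sL' : (size L' < n)%N.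
  rewrite -nL size_map size_filter -(count_predC (pred1 a) L).
  by rewrite -[X in (X < _)%N]add0n ltn_add2r -has_count has_pred1.
suff [w Ww [c Cc wc]] : tits_cone form Pi (refl form a v).
  exists (refl form a * w)%g; first by apply: WM => //; apply: refl_group.
  by exists c => //; rewrite orthM wc -orthM reflxx ?norm1.
apply: (IHn _ sL' _ L') => // b rb pb bv.
have rbv : form (refl form a b) v < 0.
  by move: bv; rewrite orth_formV reflV ?norm1.
apply/mapP; exists (refl form a b); last by rewrite -orthM reflxx ?norm1.
have [ba|/eqP ba] := eqVneq b a.
  move: rbv; rewrite ba reflE ?norm1// reflection_self ?norm1// sformNl.
  by rewrite oppr_lt0 ltNge ltW.
rewrite mem_filter; apply/andP; split.
  apply/eqP => rba; apply: (posindep_neq0 indPi Pia).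
  apply: (cone_pointed indPi); first exact: cone_mem.
  rewrite -(reflection_self (norm1 Pia)) -(reflE _ (norm1 Pia)) -{2}rba.
  by rewrite -orthM reflxx ?norm1.
apply: negL => //; last exact: refl_root_pos.
by apply: root_stable => //; apply: refl_group.
Qed.

Lemma tits_cone0 : tits_cone form Pi 0.
Proof. by apply/tits_coneP; exists [::] => b _ _; rewrite linear0r ltxx. Qed.

Lemma tits_coneD u v : tits_cone form Pi u -> tits_cone form Pi v ->
  tits_cone form Pi (u + v).
Proof.
move=> /tits_coneP[L uL] /tits_coneP[M vM]; apply/tits_coneP.
exists (L ++ M) => b rb pb; rewrite sformDr mem_cat => buv; apply/orP.
have [bu|bu] := ltP (form b u) 0; first by left; apply: uL.
by right; apply: vM => //; lra.
Qed.

Lemma tits_coneZ k v :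
  0 <= k -> tits_cone form Pi v -> tits_cone form Pi (k *: v).
Proof.
move=> k0 [w Ww [c Cc <-]]; exists w => //; exists (k *: c); last exact: orthZ.
by move=> a Pia; rewrite sformZr mulr_ge0// Cc.
Qed.

(** [v - w v] and its opposite are both in the cone, by [group_chamber_sub] for
[w] and for its inverse. *)
Lemma chamber_unique w v : W w -> fundamental_chamber form Pi v ->
  fundamental_chamber form Pi (w v) -> w v = v.
Proof.
move=> Ww Cv Cwv; apply/eqP; rewrite eq_sym -subr_eq0; apply/eqP.
apply: (cone_pointed indPi); first exact: group_chamber_sub.
have WVw : W w^-1%g.
  by case: (generated_subgroup (reflections form Pi)) => _ _; apply.
rewrite opprB; have := group_chamber_sub simple_Pi WVw Cwv.
by rewrite orthVK.
Qed.

End TitsCone.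

(** * Parabolic subsystems *)

Section Parabolic.

Variables (R : realType) (E : lmodType R) (form : {symmetric E}).
Variables Pi Delta : set E.
Hypothesis simple_Pi : simple_system form Pi.
Hypothesis sub_Pi : Delta `<=` Pi.

Lemma simple_systemS : simple_system form Delta.
Proof.
case: simple_Pi => ind norm ang; split; first exact: posindepS ind.
  by move=> a /sub_Pi/norm.
by move=> a b /sub_Pi Pia /sub_Pi Pib; apply: ang.
Qed.

Lemma simple_neq_opp a b : Pi a -> Pi b -> a <> - b.
Proof.
move=> Pia Pib ab; have [indPi _ _] := simple_Pi.
apply: (posindep_neq0 indPi Pib); apply: (cone_pointed indPi).
  exact: cone_mem.
by rewrite -ab; apply: cone_mem.
Qed.

Lemma refl_inj_simple a b : Pi a -> Pi b -> refl form a = refl form b -> a = b.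
Proof.
have [_ norm1 _] := simple_Pi.
move=> Pia Pib /refl_eq[]// => [||ab]; [exact: norm1..|].
by case: (simple_neq_opp Pia Pib).
Qed.

Lemma reflection_groupS :
  reflection_group form Delta `<=` reflection_group form Pi.
Proof.
apply: generated_sub; first exact: generated_subgroup.
by move=> w [a Da wa]; apply: generated_mem; exists a => //; apply: sub_Pi.
Qed.

Lemma simple_not_root c : Pi c -> ~ Delta c ->
  ~ orbit_set (reflection_group form Delta) Delta c.
Proof.
have [indPi _ _] := simple_Pi.
move=> Pic NDc /(root_pos_or_neg simple_systemS)[].
  move=> Dc; apply: (simple_not_cone simple_Pi Pic); apply: coneS Dc => a Da.
  by split; [apply: sub_Pi|move=> ac; apply: NDc; rewrite -ac].
move=> /(coneS sub_Pi) /(cone_pointed indPi (cone_mem Pic)).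
exact: posindep_neq0 indPi Pic.
Qed.

(** By induction on a word for [w]: the reflection in [a] could only make the
positive root [a] negative, but [a] is not in the orbit of [c], since [c] is
not a root of [Delta]. *)
Lemma parabolic_pos w c : reflection_group form Delta w -> Pi c -> ~ Delta c ->
  nonneg_cone Pi (w c).
Proof.
move=> /(reflection_groupP simple_systemS)[x Dx ->] Pic NDc.
elim: x Dx => [_|a x IHx /word_cons[Da Dx]].
  by rewrite wprod_nil; apply: cone_mem.
have Wx : reflection_group form Delta (wprod (refl form) x).
  by apply/(reflection_groupP simple_systemS); exists x.
rewrite wprod_cons orthM; apply: refl_root_pos => //.
- exact: sub_Pi.
- by exists (wprod (refl form) x); [apply: reflection_groupS|exists c].
- exact: IHx.
move=> xc; apply: (simple_not_root Pic NDc).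
exists (wprod (refl form) x)^-1%g; last by exists a => //; rewrite -xc orthVK.
by case: (generated_subgroup (reflections form Delta)) => _ _; apply.
Qed.

End Parabolic.

(** * A reflection group preserving a simple system *)

Section Action.

Variables (R : realType) (E : lmodType R) (form : {symmetric E}).
Variables Delta tPi : set E.
Hypothesis simple_Delta : simple_system form Delta.
Hypothesis simple_tPi : simple_system form tPi.
Hypothesis stable_tPi : orbit_set (reflection_group form Delta) tPi `<=` tPi.
Implicit Types (a b u v : E) (w : orthogonal_group form).

Let W' := reflection_group form Delta.
Let tW := reflection_group form tPi.
Let norm1 a : tPi a -> form a a = 1.
Proof. by case: simple_tPi => _ + _; apply. Qed.
Let W'V w : W' w -> W' w^-1%g.
Proof. by case: (generated_subgroup (reflections form Delta)) => _ _; apply. Qed.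

Lemma stable_mem w a : W' w -> tPi a -> tPi (w a).
Proof. by move=> Ww Pia; apply: stable_tPi; exists w => //; exists a. Qed.

Lemma conj_reflections w x : W' w -> reflections form tPi x ->
  reflections form tPi (w * x * w^-1)%g.
Proof.
move=> Ww /reflectionsP[]// a Pia ->; rewrite refl_conj ?norm1//.
by apply: reflections_refl => //; apply: stable_mem.
Qed.

Lemma conj_reflection_group w x : W' w -> tW x -> tW (w * x * w^-1)%g.
Proof.
by move=> Ww; apply: generated_conj => s /(conj_reflections Ww)/generated_mem.
Qed.

Lemma stabilizer_automorphism w : W' w ->
  root_system_automorphism (orbit_set tW tPi) tPi w.
Proof.
move=> Ww; have WVw := W'V Ww; split; split.
- by move=> a; apply: stable_mem.
- by move=> a b _ _; apply: orth_inj.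
- by move=> a Pia; exists (w^-1%g a); [apply: stable_mem|apply: orthKV].
- move=> _ [x tWx [a Pia <-]]; exists (w * x * w^-1)%g.
    exact: conj_reflection_group.
  by exists (w a); [apply: stable_mem|rewrite !orthM orthVK].
- by move=> a b _ _; apply: orth_inj.
- move=> _ [x tWx [a Pia <-]]; exists (w^-1%g (x a)); last exact: orthKV.
  exists (w^-1 * x * w)%g.
    by have := conj_reflection_group WVw tWx; rewrite invgK.
  by exists (w^-1%g a); [apply: stable_mem|rewrite !orthM orthKV].
Qed.

Lemma stabilizer_coxeter_automorphism w : W' w ->
  coxeter_automorphism tW (reflections form tPi) (fun x => (w * x * w^-1)%g).
Proof.
move=> Ww; have WVw := W'V Ww.
have conjKV x : (w * (w^-1 * x * w) * w^-1 = x)%g.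
  by rewrite !mulgA mulgV mul1g mulgK.
split.
- split.
  + by move=> x; apply: conj_reflection_group.
  + by move=> x y _ _ /mulIg/mulgI.
  + move=> x tWx; exists (w^-1 * x * w)%g => //.
    by have := conj_reflection_group WVw tWx; rewrite invgK.
- by move=> x y _ _; rewrite !mulgA mulgVK.
- apply/seteqP; split=> [_ [x tJx <-]|x tJx]; first exact: conj_reflections.
  exists (w^-1 * x * w)%g => //.
  by have := conj_reflections WVw tJx; rewrite invgK.
Qed.

(** A nontrivial element of [tW] makes some element of [tPi] negative, whereas
[W'] maps [tPi] to itself. *)
Lemma stabilizer_trivial : tW `&` W' = [set 1%g].
Proof.
have [indPi _ _] := simple_tPi.
apply/seteqP; split=> [w [tWw Ww]|_ ->]; last first.
  split; first by case: (generated_subgroup (reflections form tPi)).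
  by case: (generated_subgroup (reflections form Delta)).
apply: contrapT => /(group_descent simple_tPi tWw)[a Pia].
have Piwa := stable_mem Ww Pia.
move/(cone_pointed indPi (cone_mem Piwa)); exact: posindep_neq0 indPi Piwa.
Qed.

Lemma stabilizer_semidirect : semidirect (generated (W' `|` tW)) tW W'.
Proof.
apply: semidirect_generated; [exact: generated_subgroup..| |].
  by move=> w x; apply: conj_reflection_group.
exact: stabilizer_trivial.
Qed.

(** The products between the two parts are the point: they come from the pair [b],
[b'] in [tPi], where [b'] is the reflection of [b] in [a]. *)
Lemma merge_simple_system :
  positively_independent (Delta `|` tPi) ->
  simple_system form
    (Delta `|` (tPi `&` -%R @` fundamental_chamber form Delta)).
Proof.
move=> ind; have [_ D1 Dang] := simple_Delta; have [_ _ tang] := simple_tPi.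
have mixed a b : Delta a -> tPi b ->
    (-%R @` fundamental_chamber form Delta) b -> (-%R @` @COS R) (form a b).
  move=> Da tb [c Cc cb]; exists (- form a b); last exact: opprK.
  set k := - form a b; have k0 : 0 <= k by rewrite /k -cb sformNr opprK Cc.
  pose b' := refl form a b.
  have b'E : b' = b + (2 * k) *: a.
    by rewrite /b' reflE ?D1// /reflection form_sym mulrN scaleNr.
  have tb' : tPi b' by apply: stable_mem => //; apply: refl_group.
  have [bb'|bb'] := pselect (b' = b).
    have -> : k = 0.
      have : (2 * k) *: a = 0 by apply: (addrI b); rewrite -b'E bb' addr0.
      move/(congr1 (form a)); rewrite sformZr D1// linear0r mulr1.
      by move/eqP; rewrite mulf_eq0 pnatr_eq0 => /eqP.
    by left; exists 2%N => //; exact: cos_pihalf.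
  apply: COS_half => //; have [d COSd dE] := tang _ _ tb' tb bb'.
  suff <- : d = 2 * k ^+ 2 - 1 by [].
  move: dE; rewrite b'E sformDl sformZl norm1// -[form a b]opprK -/k => dE.
  by rewrite -[d]opprK dE; ring.
split.
- by apply: posindepS ind => a [|[]]; [left|right].
- by move=> a [|[/norm1]]//; apply: D1.
move=> a b [Da|[ta Ca]] [Db|[tb Cb]] ab.
- exact: Dang.
- exact: mixed.
- by rewrite form_sym; apply: mixed.
- exact: tang.
Qed.

(** An element of [tPi] is the image under [W'] of a vector of the opposite of the
chamber, which is again in [tPi]. *)
Lemma merge_orbit : tPi `<=` -%R @` tits_cone form Delta ->
  tPi = orbit_set W'
    ((Delta `|` (tPi `&` -%R @` fundamental_chamber form Delta)) `\` Delta).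
Proof.
move=> tX; apply/seteqP; split=> [b tb|]; last first.
  by move=> _ [w Ww [a [[//|[ta _]] _] <-]]; exact: stable_mem.
have [_ [w Ww [c Cc <-]] wcb] := tX b tb.
have bE : w^-1%g b = - c by rewrite -wcb orthN orthVK.
exists w => //; exists (- c); last by rewrite orthN.
split.
  right; split; last by exists c.
  by rewrite -bE; apply: stable_mem => //; apply: W'V.
have [_ D1 _] := simple_Delta.
move=> Dc; have := Cc _ Dc; rewrite -[X in form _ X]opprK sformNr D1//.
by rewrite oppr_ge0 ler10.
Qed.

End Action.

(** * Extending a simple system by part of another *)

Section Extension.

Variables (R : realType) (E : lmodType R) (form : {symmetric E}).
Variables Delta tPi Pi : set E.
Hypothesis simple_Pi : simple_system form Pi.
Hypothesis simple_tPi : simple_system form tPi.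
Hypothesis stable_tPi : orbit_set (reflection_group form Delta) tPi `<=` tPi.
Hypothesis sub_Pi : Delta `<=` Pi.
Hypothesis Pi_sub : Pi `<=` Delta `|` tPi.
Hypothesis tPiE : tPi = orbit_set (reflection_group form Delta) (Pi `\` Delta).
Implicit Types (a b u v : E) (w : orthogonal_group form).

Let W' := reflection_group form Delta.
Let tW := reflection_group form tPi.
Let C := fundamental_chamber form Delta.
Let X := tits_cone form Delta.
Let simple_Delta := simple_systemS simple_Pi sub_Pi.
Let tnorm1 a : tPi a -> form a a = 1.
Proof. by case: simple_tPi => _ + _; apply. Qed.
Let indPi : positively_independent Pi. Proof. by case: simple_Pi. Qed.
Let norm1 a : Pi a -> form a a = 1.
Proof. by case: simple_Pi => _ + _; apply. Qed.

Lemma extension_chamber a : Pi a -> ~ Delta a -> (-%R @` C) a.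
Proof.
move=> Pia NDa; exists (- a); last exact: opprK.
move=> d Dd; rewrite sformNr oppr_ge0 (simple_form_le0 simple_Pi)//.
  exact: sub_Pi.
by move=> da; apply: NDa; rewrite -da.
Qed.

Lemma extension_posindep : positively_independent (Delta `|` tPi).
Proof.
apply: (posindep_sub_cone indPi).
  move=> a [/sub_Pi|]; first exact: cone_mem.
  rewrite tPiE => -[w Ww [b [Pib NDb] <-]].
  exact: (parabolic_pos simple_Pi sub_Pi).
move=> a [/sub_Pi/(posindep_neq0 indPi)//|/posindep_neq0]; apply.
by case: simple_tPi.
Qed.

Lemma extension_tits : tPi `<=` -%R @` X.
Proof.
move=> a; rewrite tPiE => -[w Ww [b [Pib NDb] <-]].
have [c Cc <-] := extension_chamber Pib NDb.
by exists (w c); [exists w => //; exists c|rewrite orthN].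
Qed.

Lemma extension_sub : Pi `\` Delta `<=` tPi.
Proof. by move=> a [/Pi_sub[]]. Qed.

(** An element [w b] of [tPi] in the opposite of the chamber equals [b], because
[b] is there too. *)
Lemma extensionE : Pi = Delta `|` (tPi `&` -%R @` C).
Proof.
apply/seteqP; split=> a.
  move=> Pia; have [|NDa] := pselect (Delta a); [by left|right].
  by split; [apply: extension_sub|apply: extension_chamber].
case=> [/sub_Pi//|[]]; rewrite tPiE => -[w Ww [b [Pib NDb] <-]] [c Cc cwb].
have [d Cd db] := extension_chamber Pib NDb.
have wdc : w d = c by apply: oppr_inj; rewrite -orthN db.
suff -> : w b = b by [].
rewrite -db orthN (chamber_unique simple_Delta Ww Cd)//.
by rewrite wdc.
Qed.

Lemma extension_disjoint : Delta `&` (tPi `&` -%R @` C) = set0.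
Proof.
apply/seteqP; split=> // a [Da [_ [c Cc ca]]].
have := Cc _ Da; rewrite -[c]opprK ca sformNr norm1 ?oppr_ge0 ?ler10//.
exact: sub_Pi.
Qed.

Lemma extension_reflection_group :
  generated (W' `|` tW) = reflection_group form Pi.
Proof.
have [_ PM PV] := generated_subgroup (reflections form Pi).
have W'P : W' `<=` reflection_group form Pi by apply: reflection_groupS.
apply/seteqP; split; apply: generated_sub; try exact: generated_subgroup.
  move=> w [/W'P//|]; move: w; apply: generated_sub.
    exact: generated_subgroup.
  move=> w /reflectionsP[]// a.
  rewrite tPiE => -[w' /W'P Pw' [b [Pib _] <-]] ->.
  rewrite -refl_conj ?norm1//; apply: (PM); last exact: PV.
  by apply: PM => //; apply: refl_group.
move=> w [a /Pi_sub[Da|ta] wa]; apply: generated_mem; [left|right];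
  by apply: generated_mem; exists a.
Qed.

Lemma extension_roots :
  orbit_set W' Delta `|` orbit_set tW tPi `<=`
    orbit_set (reflection_group form Pi) Pi.
Proof.
have W'P : W' `<=` reflection_group form Pi by apply: reflection_groupS.
have tWP : tW `<=` reflection_group form Pi.
  by rewrite -extension_reflection_group => w tWw; apply: generated_mem; right.
move=> _ [[w /W'P Pw [a /sub_Pi Pia <-]]|[w /tWP Pw [a + <-]]].
  by exists w => //; exists a.
rewrite tPiE => -[w' /W'P Pw' [b [Pib _] <-]].
exists (w * w')%g; last by exists b.
by have [_ + _] := generated_subgroup (reflections form Pi); apply.
Qed.

(** The opposite of the Tits cone is a convex cone containing [tPi]. *)
Lemma extension_positive_roots :
  positive_roots (orbit_set tW tPi) tPi `<=` -%R @` X.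
Proof.
move=> b [_]; suff: nonneg_cone tPi `<=` [set v | X (- v)].
  by move=> /[apply] Xb; exists (- b); last exact: opprK.
apply: cone_ind.
  by rewrite /= oppr0; apply: tits_cone0.
move=> k a v k0 /extension_tits[c Xc <-] Xv; rewrite /= scalerN opprD opprK.
by apply: tits_coneD => //; apply: tits_coneZ.
Qed.

Lemma extension_reflections : reflections form tPi =
  [set (w * s * w^-1)%g | w in W'
                        & s in reflections form Pi `\` reflections form Delta].
Proof.
have D1 a : Delta a -> form a a = 1 by move=> /sub_Pi/norm1.
apply/seteqP; split=> [x /reflectionsP[]// a|y [w Ww [x []]]].
  rewrite tPiE => -[w Ww [b [Pib NDb] <-]] ->.
  exists w => //; exists (refl form b); last by rewrite refl_conj ?norm1.
  split; first exact: reflections_refl.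
  move=> /reflectionsP[]// d Dd /(refl_inj_simple simple_Pi Pib (sub_Pi Dd)) bd.
  by apply: NDb; rewrite bd.
move=> /reflectionsP[]// a Pia -> NDa <-; rewrite refl_conj ?norm1//.
apply: reflections_refl => //; apply: stable_tPi.
exists w => //; exists a => //.
apply: extension_sub; split=> // Da; apply: NDa.
exact: reflections_refl.
Qed.

(** [t] is in the normal subgroup [tW], so its conjugate [s] would be as well, and
[tW] meets [W'] trivially. *)
Lemma extension_not_conjugate s t w : reflections form Delta s ->
  (reflections form Pi `\` reflections form Delta) t ->
  generated (W' `|` tW) w ->
  (w * s * w^-1)%g <> t.
Proof.
move=> Is Jt Ww wst.
have [subtW _ norm_tW _ tWW'] := stabilizer_semidirect simple_tPi stable_tPi.
have tWt : tW t.
  apply: generated_mem; rewrite extension_reflections.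
  exists 1%g; first by case: (generated_subgroup (reflections form Delta)).
  by exists t => //; rewrite mul1g invg1 mulg1.
have [_ _ WV] := generated_subgroup (W' `|` tW).
have tWs : tW s.
  have := norm_tW _ _ (WV _ Ww) tWt.
  by rewrite -wst invgK !mulgA mulVg mul1g mulgVK.
have : (tW `&` W') s by split=> //; apply: generated_mem.
rewrite tWW' => s1; move: Is; rewrite s1 => /reflectionsP[|a Da].
  by move=> a /sub_Pi/norm1.
by move/esym; apply: refl_neq1; apply/norm1/sub_Pi.
Qed.

End Extension.

Theorem theorem3p11 (R : realType) (E : lmodType R) (form : {symmetric E})
    (Psi Delta tPhi tPi : set E) :
  based_root_system form Psi Delta ->
  based_root_system form tPhi tPi ->
  let I' := reflections form Delta in
  let W' := reflection_group form Delta in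
  let tJ := reflections form tPi in
  let tW := reflection_group form tPi in
  let C := fundamental_chamber form Delta in
  let X := tits_cone form Delta in
  orbit_set W' tPi `<=` tPi ->
  let W := generated (W' `|` tW) in
  let condition_i Phi Pi :=
    [/\ based_root_system form Phi Pi,
        Delta `<=` Pi,
        Pi `<=` Delta `|` tPi
      & tPi = orbit_set W' (Pi `\` Delta)] in
  let condition_ii :=
    positively_independent (Delta `|` tPi) /\ tPi `<=` -%R @` X in
  [/\ forall w, W' w -> root_system_automorphism tPhi tPi w,
      forall w, W' w ->
        coxeter_automorphism tW tJ (fun x => (w * x * w^-1)%g),
      semidirect W tW W',
      (exists Phi Pi, condition_i Phi Pi) <-> condition_ii
    & forall Phi Pi, condition_i Phi Pi ->
      let S := reflections form Pi in
      let J := S `\` I' in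
      let W_I := generated I' in
      [/\ Pi = Delta `|` (tPi `&` -%R @` C) /\
            Delta `&` (tPi `&` -%R @` C) = set0,
          forall Phi1 Pi1, condition_i Phi1 Pi1 -> Phi1 = Phi /\ Pi1 = Pi,
          Psi `|` tPhi `<=` Phi,
          positive_roots tPhi tPi `<=` -%R @` X
        & [/\ associated_coxeter_system Pi W S,
              tJ = [set (w * s * w^-1)%g | w in W' & s in J],
              (forall s t w, I' s -> J t -> W w -> (w * s * w^-1)%g <> t),
              I' `<=` S
            & [/\ W_I = W',
                  tW = generated [set (w * s * w^-1)%g | w in W_I & s in J]
                & semidirect W tW W_I]]]].
Proof.
move=> [Dind D1 Dang ->] [tind t1 tang ->].
move=> I' W' tJ tW C X stab W cond_i cond_ii.
have sD : simple_system form Delta by [].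
have sT : simple_system form tPi by [].
have semi : semidirect W tW W' by exact: stabilizer_semidirect.
split=> //.
- exact: stabilizer_automorphism.
- exact: stabilizer_coxeter_automorphism.
- split=> [[Phi [Pi [[ind n1 ang _] DP PD tE]]]|[ind tX]].
    have sP : simple_system form Pi by [].
    by split; [exact: extension_posindep tE|exact: extension_tits tE].
  pose Pi := Delta `|` (tPi `&` -%R @` C).
  exists (orbit_set (reflection_group form Pi) Pi), Pi.
  have [Pind P1 Pang] := merge_simple_system sD sT stab ind.
  split=> //; [by left|by move=> a [|[]]; [left|right]|].
  exact: merge_orbit.
move=> Phi Pi [[ind n1 ang PhiE] DP PD tE] S J W_I.
have sP : simple_system form Pi by [].
have PiE : Pi = Delta `|` (tPi `&` -%R @` C) by exact: extensionE.
have tJE : tJ = [set (w * s * w^-1)%g | w in W' & s in J].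
  exact: extension_reflections.
split=> //.
- by split=> //; exact: (extension_disjoint _ sP DP).
- move=> Phi1 Pi1 [[ind1 n11 ang1 ->] DP1 PD1 tE1].
  have sP1 : simple_system form Pi1 by [].
  suff -> : Pi1 = Pi by [].
  by rewrite PiE; exact: extensionE.
- by rewrite PhiE; apply: extension_roots.
- exact: extension_positive_roots tE.
split=> //.
- split=> //; first exact: extension_reflection_group.
  rewrite /W (extension_reflection_group sP sT DP PD tE).
  exact: simple_system_coxeter.
- by move=> s t w; exact: extension_not_conjugate.
- by move=> w [a Da wa]; exists a => //; exact: DP.
split=> //.
by rewrite -tJE.
Qed.
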